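(* Let $m,n$ be positive integers with $$\frac mn\in\left[\tfrac12,2\right],\qquad \{m,n\}\notin\{\{1,1\},\{2,3\}\}.$$ Then $FS_{m,n}(\|\cdot\|_\infty,\|\cdot\|_\infty)\ne\emptyset$, and in fact $$\dim_H FS_{m,n}(\|\cdot\|_\infty,\|\cdot\|_\infty)\ \ge\ mn-2\max\{m,n\}.$$ Moreover, these claims remain true when restricting to matrices of full $\mathbb{R}$-rank $\min\{m,n\}$. If additionally $m\ne n$, then more generally for any norms $\|\cdot\|_1$ on $\mathbb{R}^n$ and $\|\cdot\|_2$ on $\mathbb{R}^m$ $$FS_{m,n}(\|\cdot\|_1,\|\cdot\|_2)\ne\emptyset,\qquad \dim_H FS_{m,n}(\|\cdot\|_1,\|\cdot\|_2)\ \ge\ mn-2\max\{m,n\},$$ and the Dirichlet spectrum $\mathcal{D}_{m,n}(\|\cdot\|_1,\|\cdot\|_2)$ accumulates at $0$; in particular, it is not finite.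
   Context: For norms $\|\cdot\|_1$ on $\mathbb{R}^n$ and $\|\cdot\|_2$ on $\mathbb{R}^m$, $\Omega\in\mathbb{R}^{m\times n}$ and $t\ge1$ let $$\psi_\Omega(t)=\min\{\|\Omega\hat{\boldsymbol b}+\tilde{\boldsymbol b}\|_2:\hat{\boldsymbol b}\in\mathbb{Z}^n,\ \tilde{\boldsymbol b}\in\mathbb{Z}^m,\ 1\le\|\hat{\boldsymbol b}\|_1\le t\},$$ $\Theta(\Omega)=\limsup_{t\to\infty}t^{n/m}\psi_\Omega(t)$, $\widetilde\Theta(\Omega)=\liminf_{t\to\infty}t^{n/m}\psi_\Omega(t)$, and $D=\sup_{\Omega\in\mathbb{R}^{m\times n}}\Theta(\Omega)<\infty$ (all depending on the norms). Put $Di_{m,n}(\|\cdot\|_1,\|\cdot\|_2)=\{\Omega:\Theta(\Omega)<D\}$, $Sing_{m,n}=\{\Omega:\Theta(\Omega)=0\}$, $Bad_{m,n}=\{\Omega:\widetilde\Theta(\Omega)>0\}$ (the last two do not depend on the norms), and $$FS_{m,n}(\|\cdot\|_1,\|\cdot\|_2)=Di_{m,n}(\|\cdot\|_1,\|\cdot\|_2)\setminus(Bad_{m,n}\cup Sing_{m,n}).$$ The Dirichlet spectrum is $\mathcal{D}_{m,n}(\|\cdot\|_1,\|\cdot\|_2)=\{\Theta(\Omega):\Omega\in\mathbb{R}^{m\times n}\}\subseteq[0,D]$. $\|\cdot\|_\infty$ is the maximum norm and $\dim_H$ is Hausdorff dimension. *)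

(* Defs.v *)
From HB Require Import structures.
From mathcomp Require Import all_boot all_order all_algebra.
From mathcomp Require Import all_classical all_reals all_analysis.

Set Implicit Arguments.
Unset Strict Implicit.
Unset Printing Implicit Defensive.

Import Order.TTheory GRing.Theory Num.Theory.
Import numFieldNormedType.Exports.

Local Open Scope classical_set_scope.
Local Open Scope ring_scope.
Local Open Scope ereal_scope.

(* Nonnegativity of N follows from these three axioms. *)
Definition is_norm (R : realType) (k : nat) (N : 'cV[R]_k -> R) : Prop :=
  [/\ forall x y, (N (x + y) <= N x + N y)%R,
      forall (a : R) x, N (a *: x)%R = (`|a| * N x)%R
    & forall x, N x = 0%R -> x = 0%R].

(* The canonical norm on matrices is the maximum of the absolute values of the
   entries. *)
Definition max_norm (R : realType) (k : nat) (x : 'cV[R]_k) : R := `|x|%R.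

(* An infimum in \bar R: it is a minimum as soon as some integer vector satisfies
   1 <= N1 b <= t, hence for all large t, and +oo otherwise. *)
Definition psi (R : realType) (m n : nat)
    (N1 : 'cV[R]_n -> R) (N2 : 'cV[R]_m -> R)
    (Omega : 'M[R]_(m, n)) (t : R) : \bar R :=
  ereal_inf [set (N2 (Omega *m map_mx intr bc.1 + map_mx intr bc.2)%R)%:E
            | bc in [set bc : 'cV[int]_n * 'cV[int]_m |
                      (1 <= N1 (map_mx intr bc.1) <= t)%R]].

Definition scaled_psi (R : realType) (m n : nat)
    (N1 : 'cV[R]_n -> R) (N2 : 'cV[R]_m -> R)
    (Omega : 'M[R]_(m, n)) (t : R) : \bar R :=
  (t `^ (n%:R / m%:R))%:E * psi N1 N2 Omega t.

Definition Theta (R : realType) (m n : nat)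
    (N1 : 'cV[R]_n -> R) (N2 : 'cV[R]_m -> R) (Omega : 'M[R]_(m, n)) : \bar R :=
  limf_esup (scaled_psi N1 N2 Omega) (pinfty_nbhs R).

Definition Theta_inf (R : realType) (m n : nat)
    (N1 : 'cV[R]_n -> R) (N2 : 'cV[R]_m -> R) (Omega : 'M[R]_(m, n)) : \bar R :=
  limf_einf (scaled_psi N1 N2 Omega) (pinfty_nbhs R).

Definition dirichlet_spectrum (R : realType) (m n : nat)
    (N1 : 'cV[R]_n -> R) (N2 : 'cV[R]_m -> R) : set (\bar R) :=
  range (@Theta R m n N1 N2).

Definition dirichlet_constant (R : realType) (m n : nat)
    (N1 : 'cV[R]_n -> R) (N2 : 'cV[R]_m -> R) : \bar R :=
  ereal_sup (dirichlet_spectrum N1 N2).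

Definition Di (R : realType) (m n : nat)
    (N1 : 'cV[R]_n -> R) (N2 : 'cV[R]_m -> R) : set 'M[R]_(m, n) :=
  [set Omega | Theta N1 N2 Omega < dirichlet_constant N1 N2].

(* Sing and Bad do not depend on the norms; they are computed here with the
   norms at hand. *)
Definition Sing (R : realType) (m n : nat)
    (N1 : 'cV[R]_n -> R) (N2 : 'cV[R]_m -> R) : set 'M[R]_(m, n) :=
  [set Omega | Theta N1 N2 Omega = 0].

Definition Bad (R : realType) (m n : nat)
    (N1 : 'cV[R]_n -> R) (N2 : 'cV[R]_m -> R) : set 'M[R]_(m, n) :=
  [set Omega | 0 < Theta_inf N1 N2 Omega].

Definition FS (R : realType) (m n : nat)
    (N1 : 'cV[R]_n -> R) (N2 : 'cV[R]_m -> R) : set 'M[R]_(m, n) :=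
  Di N1 N2 `\` (Bad N1 N2 `|` Sing N1 N2).

Definition full_rank (R : realType) (m n : nat) : set 'M[R]_(m, n) :=
  [set Omega | \rank Omega = minn m n].

(* The diameter of the empty set is -oo. *)
Definition diameter (R : realType) (V : normedModType R) (A : set V) : \bar R :=
  ereal_sup [set (`|x - y|%R)%:E | x in A & y in A].

(* |A|^s, where |set0|^s = 0 for every s and |{x}|^0 = 1. *)
Definition hausdorff_gauge (R : realType) (V : normedModType R)
    (s : R) (A : set V) : \bar R :=
  if A == set0 then 0 else poweR (diameter A) s.

Definition hausdorff_premeasure (R : realType) (V : normedModType R)
    (s delta : R) (A : set V) : \bar R :=
  ereal_inf [set \sum_(0 <= i <oo) hausdorff_gauge s (U i)
            | U in [set U : (set V)^nat |
                     A `<=` \bigcup_i U i /\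
                     forall i, diameter (U i) <= delta%:E]].

Definition hausdorff_measure (R : realType) (V : normedModType R)
    (s : R) (A : set V) : \bar R :=
  ereal_sup [set hausdorff_premeasure s delta A
            | delta in [set delta : R | (0 < delta)%R]].

Definition hausdorff_dim (R : realType) (V : normedModType R) (A : set V) :
    \bar R :=
  ereal_inf [set s%:E
            | s in [set s : R | (0 <= s)%R /\ hausdorff_measure s A = 0]].

(* Main.v *)
(* Put w = n/m.  Call a matrix A with m rows and k <= 2 columns a singular block
   of level e when t^w psi_A(t) <= e for all large t, liminf t^w psi_A(t) = 0,
   but t^w psi_A(t) >= c > 0 for some arbitrarily large t.  Such blocks exist
   for every e > 0: let x and y be the sums of 1/Q_i over even and odd i, where
   the Q_i are powers of 2.  Up to zero rows, take
   - for m > n the column (x, y), with Q_{i+1}^(1-w) close to Q_i / e;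
   - for 2 <= m <= n the diagonal matrix diag(x, y), with Q_{i+2} close to
     Q_{i+1}^w Q_i / e;
   - for m = 1, n = 2 the row (x, y), with Q_{i+1} = Q_i^2 / e.
   Completing A with arbitrary columns B keeps the two upper bounds.  The lower
   bound survives for B in a set of positive measure: for t fixed, a union
   bound shows that with probability at least 1/2 no integer vector of norm at
   most t that involves a column of B does better than a constant times t^-w,
   and then one takes the upper limit of these events along a sequence of t.
   As B has m(n - k) >= mn - 2 max(m, n) entries, the mass distribution
   principle bounds the Hausdorff dimension from below.  Adding an integer
   matrix does not change psi, and makes the rank full.  Hence for every e > 0
   the matrices of full rank with 0 < Theta <= e that are not in Bad have the
   required dimension, for all norms; so Dirichlet's constant is positive, and
   it suffices to take e below it. *)
Require Import Defs.
From HB Require Import structures.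
From mathcomp Require Import all_boot all_order all_algebra.
From mathcomp Require Import all_classical all_reals all_analysis.
From mathcomp Require Import measurable_realfun ring lra zify.

Set Implicit Arguments.
Unset Strict Implicit.
Unset Printing Implicit Defensive.

Import Order.TTheory GRing.Theory Num.Theory.
Import numFieldNormedType.Exports.

Local Open Scope classical_set_scope.
Local Open Scope ring_scope.

(** * Dyadic series *)

(** [x] is the sum of the [2 ^ - E k] and [r / 2 ^ E i] its partial sum up to [i]. The tail lies
    between its first term and twice that term because the terms at least halve. That [r] is odd is
    stated as coprimality with all powers of 2. *)
Lemma dyadic_series (R : realType) (E : nat -> nat) :
    (forall i, (E i < E i.+1)%N) ->
  exists x : R, forall i, exists2 r : int, (forall e, coprimez (2 ^+ e) r) &
    (2 ^+ E i.+1)^-1 <= x - r%:~R / 2 ^+ E i <= 2 / 2 ^+ E i.+1.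
Proof.
move=> Emono.
have Q0 e : 0 < (2 : R) ^+ e by rewrite exprn_gt0.
pose s i : R := \sum_(0 <= k < i.+1) (2 ^+ E k)^-1.
have sS i : s i.+1 = s i + (2 ^+ E i.+1)^-1 by rewrite /s big_nat_recr.
have halve i : 2 / 2 ^+ E i.+1 <= (2 ^+ E i)^-1 :> R.
  by rewrite ler_pdivrMr// mulrC ler_pdivlMr// -exprS ler_weXn2l// ler1n.
have sint i : exists2 r : int, (forall e, coprimez (2 ^+ e) r) &
    s i = r%:~R / 2 ^+ E i.
  elim: i => [|i [r rodd rE]].
    exists 1; first by move=> e; rewrite coprimezXl// /coprimez gcdz1.
    by rewrite /s big_nat1 mul1r.
  (* Passing to the denominator [2 ^ E i.+1] multiplies the numerator by a positive power of 2, so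
     adding the new term 1 makes it odd; explicit Bezout coefficients certify this. *)
  exists (r * 2 ^+ (E i.+1 - E i) + 1).
    move=> e; apply: coprimezXl; apply/coprimezP.
    exists (- (r * 2 ^+ (E i.+1 - E i).-1), 1) => /=.
    rewrite -[in X in _ + X](prednK (n := E i.+1 - E i)) ?subn_gt0// exprS.
    by ring.
  rewrite sS rE rmorphD rmorphM rmorphXn /=.
  move: (_ - _)%N (subnK (ltnW (Emono i))) => d <-; rewrite exprD.
  by field; rewrite !gt_eqF.
have ub i j : s j <= s i + 2 / 2 ^+ E i.+1.
  (* [s (k + i)] plus twice the next term does not increase with [k], which bounds all partial sums
     from above at once. *)
  have sub k : s (k + i)%N + 2 / 2 ^+ E (k + i).+1 <= s i + 2 / 2 ^+ E i.+1.
    elim: k => [//|k]; apply: le_trans.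
    by rewrite addSn sS; have := halve (k + i).+1; lra.
  have smono a b : (a <= b)%N -> s a <= s b.
    move=> /subnK <-; elim: (b - a)%N => [//|k]; move/le_trans; apply.
    by rewrite addSn sS lerDl invr_ge0 ltW.
  have := sub j; apply: le_trans.
  apply: le_trans (smono _ _ (leq_addr i j)) _.
  by rewrite lerDl divr_ge0 ?ltW.
have sne : range s !=set0 by exists (s 0%N), 0%N.
have shas : has_ubound (range s).
  by exists (s 0%N + 2 / 2 ^+ E 1%N) => _ [j _ <-]; exact: ub.
exists (sup (range s)) => i.
have [r rodd rE] := sint i; exists r => //; rewrite -rE; apply/andP; split.
  rewrite lerBrDr addrC -sS; apply: ub_le_sup => //; by exists i.+1.
by rewrite lerBlDr addrC; apply: ge_sup => // _ [j _ <-]; exact: ub.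
Qed.

(** Two series share the scales, one taking the even and one the odd indices. The one of the parity
    of [i], cut at [i], has denominator [2 ^ E i] and an error governed by [E i.+2], the next index
    of that parity. *)
Lemma interleaved_dyadic_series (R : realType) (E : nat -> nat) :
    (forall i, (E i < E i.+1)%N) ->
  exists x : bool -> R, forall i, exists2 r : int,
    (forall e, coprimez (2 ^+ e) r) &
    (2 ^+ E i.+2)^-1 <= x (odd i) - r%:~R / 2 ^+ E i <= 2 / 2 ^+ E i.+2.
Proof.
move=> Emono.
have [|x0 h0] := @dyadic_series R (fun k => E k.*2).
  by move=> i; rewrite doubleS; apply: ltn_trans (Emono _).
have [|x1 h1] := @dyadic_series R (fun k => E k.*2.+1).
  by move=> i; rewrite doubleS; apply: ltn_trans (Emono _).
exists (fun b => if b then x1 else x0) => i.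
move: (odd_double_half i); move: i./2 => j; case: (odd i) => <-.
  by have := h1 j; rewrite doubleS add1n.
by have := h0 j; rewrite doubleS add0n.
Qed.

(** Replacing [x] by [r / 2 ^ e] turns the form into an integer multiple of [2 ^ f / 2 ^ e], which
    is nonzero because [r] is odd and [2 ^ e] does not divide [y]. *)
Lemma dyadic_form_lower (R : realType) (e f : nat) (x B : R) (r y p : int) :
    (forall e, coprimez (2 ^+ e) r) -> 0 <= x - r%:~R / 2 ^+ e <= B ->
    (2 ^+ f %| y)%Z -> ~~ (2 ^+ e %| y)%Z ->
  2 ^+ f / 2 ^+ e - `|y|%:~R * B <= `|y%:~R * x + p%:~R|.
Proof.
move=> rodd /andP[x0 xB] /dvdzP[z yE] ney.
have Q0 k : 0 < (2 : R) ^+ k by rewrite exprn_gt0.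
have fe : (f < e)%N.
  rewrite ltnNge; apply: contra ney => ef.
  by apply/dvdzP; exists (z * 2 ^+ (f - e)); rewrite yE -mulrA -exprD subnK.
have -> : y%:~R * x + p%:~R = (z * r + p * 2 ^+ (e - f))%:~R * (2 ^+ f / 2 ^+ e)
    + y%:~R * (x - r%:~R / 2 ^+ e) :> R.
  rewrite yE !(rmorphD, rmorphM, rmorphXn) /=.
  move: (e - f)%N (subnK (ltnW fe)) => d <-; rewrite exprD.
  by field; rewrite !gt_eqF.
have nz : z * r + p * 2 ^+ (e - f) != 0.
  apply: contra ney; rewrite addr_eq0 => /eqP zr.
  rewrite -(Gauss_dvdzl _ (rodd e)) yE mulrAC zr -mulNr -mulrA -exprD subnK ?(ltnW fe)//.
  exact: dvdz_mull.
apply: (le_trans _ (lerB_normD _ _)); apply: lerB; last first.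
  by rewrite normrM intr_norm ler_wpM2l// ger0_norm.
have F0 : 0 <= (2 : R) ^+ f / 2 ^+ e by rewrite divr_ge0 ?ltW.
rewrite normrM (ger0_norm F0) ler_peMl//.
by rewrite -intr_norm ler1z -gtz0_ge1 normr_gt0.
Qed.

(** In the complementary case [y * r / 2 ^ e + p] is an integer. If it is nonzero, it is at least 1
    in modulus; if it vanishes, only [y * (x - r / 2 ^ e)] is left, and the lower bound [A] on the
    error takes over. *)
Lemma dyadic_form_lower_dvd (R : realType) (e : nat) (x A B : R) (r y p : int) :
    (forall e, coprimez (2 ^+ e) r) -> 0 <= A -> A <= x - r%:~R / 2 ^+ e <= B ->
    y != 0 -> (2 ^+ e %| y)%Z ->
  (2 ^+ e)^-1 - `|y|%:~R * B <= `|y%:~R * x + p%:~R| \/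
  2 ^+ e * A <= `|y%:~R * x + p%:~R|.
Proof.
move=> rodd A0 /andP[xA xB] y0 /dvdzP[z yE].
have Q0 k : 0 < (2 : R) ^+ k by rewrite exprn_gt0.
have -> : y%:~R * x + p%:~R = (z * r + p)%:~R
    + y%:~R * (x - r%:~R / 2 ^+ e) :> R.
  rewrite yE !(rmorphD, rmorphM, rmorphXn) /=; by field; rewrite !gt_eqF.
have x0 : 0 <= x - r%:~R / 2 ^+ e by exact: le_trans xA.
have [->|nz] := eqVneq (z * r + p) 0.
  right; rewrite add0r normrM -intr_norm (ger0_norm x0); apply: ler_pM => //.
  rewrite yE normrM rmorphM /= normrX rmorphXn /= ler_peMl ?(ltW (Q0 _))//.
  rewrite ler1z -gtz0_ge1 normr_gt0; by apply: contra_neq y0 => z0; rewrite yE z0 mul0r.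
left; apply: (le_trans _ (lerB_normD _ _)); apply: lerB; last first.
  by rewrite normrM intr_norm ler_wpM2l// ger0_norm.
(* The bound 1 is weakened to [(2 ^ e)^-1], so that this case reads like [dyadic_form_lower] with
   [f = 0]. *)
apply: (@le_trans _ _ 1); first by rewrite invf_le1// exprn_ege1// ler1n.
by rewrite -intr_norm ler1z -gtz0_ge1 normr_gt0.
Qed.

(** * Powers of two and sequences of dyadic scales *)

Section Pow2.
Variable R : realType.
Implicit Types (a b : R) (e : nat).

Lemma pow2n e : (2 : R) ^+ e = 2 `^ e%:R.
Proof. by rewrite powR_mulrn. Qed.

Lemma pow2D a b : 2 `^ a * 2 `^ b = 2 `^ (a + b).
Proof. by rewrite powRD// pnatr_eq0 implybT. Qed.

Lemma pow2S a : 2 * 2 `^ a = 2 `^ (a + 1).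
Proof. by rewrite -pow2D powRr1// mulrC. Qed.

Lemma pow2_half a : 2 `^ a = 2 `^ (a - 1) + 2 `^ (a - 1).
Proof. by rewrite -{1}(subrK 1 a) -pow2S mulr_natl mulr2n. Qed.

Lemma pow2V a : (2 `^ a)^-1 = 2 `^ (- a).
Proof. by rewrite powRN. Qed.

Lemma pow2_gt0 a : 0 < 2 `^ a.
Proof. by rewrite powR_gt0. Qed.

Lemma pow2_le a b : a <= b -> 2 `^ a <= 2 `^ b.
Proof. by apply: ler_powR; rewrite ler1n. Qed.

Lemma pow2_small (e : R) : 0 < e -> exists s : nat, 2 `^ (- s%:R) <= e.
Proof.
move=> e0; exists (Num.trunc e^-1).+1.
rewrite powRN -pow2n -[leRHS]invrK lef_pV2 ?posrE ?invr_gt0 ?exprn_gt0//.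
have ei : 0 <= e^-1 by rewrite invr_ge0 ltW.
have /andP[_ /ltW/le_trans] := truncn_itv ei; apply.
 rewrite -natrX ler_nat; exact/ltnW/ltn_expl.
Qed.

Variable E : nat -> nat.
Hypothesis Emono : forall i, (E i < E i.+1)%N.

Lemma exponents_ge i : (i <= E i)%N.
Proof. by elim: i => [//|i IHi]; exact: leq_ltn_trans (Emono i). Qed.

Lemma exponents_le i j : (i <= j)%N -> (E i <= E j)%N.
Proof.
by move=> /subnK <-; elim: (j - i)%N => [//|k /leq_trans]; apply; exact: ltnW.
Qed.

Lemma pow2_unbounded (t : R) : exists i0, forall i, (i0 <= i)%N -> t <= 2 ^+ E i.
Proof.
exists (Num.bound `|t|) => i it.
have : t <= (Num.bound `|t|)%:R.
  by apply: le_trans (ler_norm _) _; rewrite ltW// archi_boundP.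
move/le_trans; apply; rewrite -natrX ler_nat.
apply: leq_trans it _; apply: leq_trans (exponents_ge i) _.
exact/ltnW/ltn_expl.
Qed.

Lemma pow2_bracket j (t : R) : 2 ^+ E j <= t ->
  exists2 i, (j <= i)%N & 2 ^+ E i <= t <= 2 ^+ E i.+1.
Proof.
move=> jt; have [i0 /(_ _ (leqnn _)) ti0] := pow2_unbounded t.
have ex : exists i, t <= 2 ^+ E i by exists i0.
case: (ex_minnP ex) => i ti imin.
have [ij|ji] := leqP i j.
  exists j => //; rewrite jt (le_trans ti)// ler_weXn2l ?ler1n//.
  exact: leq_trans (exponents_le ij) (ltnW _).
case: i ji ti imin => // i; rewrite ltnS => ji ti imin.
exists i => //; rewrite ti andbT leNgt; apply/negP => /ltW/imin.
by rewrite ltnn.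
Qed.

End Pow2.

(** * Pairs of dyadic series that are singular to a given level *)

Lemma dyadic_form_upper (R : realType) (e f : nat) (x B : R) (r : int) :
    (f <= e)%N -> 0 <= x - r%:~R / 2 ^+ f <= B ->
  `|(2 ^+ e)%:~R * x + (- (r * 2 ^+ (e - f)))%:~R| <= 2 ^+ e * B.
Proof.
move=> fe /andP[x0 xB].
have -> : (2 ^+ e)%:~R * x + (- (r * 2 ^+ (e - f)))%:~R
    = 2 ^+ e * (x - r%:~R / 2 ^+ f).
  rewrite !(rmorphN, rmorphM, rmorphXn) /=.
  move: (e - f)%N (subnK fe) => d <-; rewrite exprD; field.
  by rewrite gt_eqF// exprn_gt0.
by rewrite ger0_norm ?mulr_ge0// ler_wpM2l.
Qed.

Lemma exists_iter (g : nat -> nat) :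
  exists E : nat -> nat, forall i, E i.+1 = g (E i).
Proof. by exists (fun i => iter i g 0%N). Qed.

Lemma exists_iter2 (g : nat -> nat -> nat) :
  exists E : nat -> nat, [/\ E 0%N = 0%N, E 1%N = 1%N &
    forall i, E i.+2 = g (E i) (E i.+1)].
Proof. by exists (fun i => (iter i (fun u => (u.2, g u.1 u.2)) (0, 1)%N).1). Qed.

Lemma dyadic_ndvd (e : nat) (y : int) : y != 0 -> `|y| < 2 ^+ e ->
  ~~ (2 ^+ e %| y)%Z.
Proof.
move=> y0 ye; apply: contraTN ye => /dvdzP[z yE].
rewrite -leNgt yE normrM normrX ler_peMl ?exprn_ge0// -gtz0_ge1 normr_gt0.
by apply: contra_neq y0 => z0; rewrite yE z0 mul0r.
Qed.

(** The denominator [2 ^ E i] serves both series and leaves errors of order [2 ^ (E i - E i.+1)]. It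
    is used up to [t = 2 ^ E i.+1], where the factor [t ^ w] turns them into
    [2 ^ (E i - (1 - w) * E i.+1)]; the recursion keeps this of order [2 ^ - s]. *)
Lemma singular_column (R : realType) (w e : R) : 1 / 2 <= w -> w < 1 -> 0 < e ->
  exists x : bool -> R,
  [/\ exists t0, forall t, t0 <= t -> exists (q : int) (p : bool -> int),
        [/\ q != 0, `|q|%:~R <= t &
          forall b, t `^ w * `|q%:~R * x b + (p b)%:~R| <= e],
      exists2 c, 0 < c & forall t0, exists2 t, t0 <= t &
        forall (q : int) (p : bool -> int), q != 0 -> `|q|%:~R <= t ->
          exists b, c <= t `^ w * `|q%:~R * x b + (p b)%:~R|
    & forall h t0, 0 < h -> exists2 t, t0 <= t &
        exists (q : int) (p : bool -> int),
        [/\ q != 0, `|q|%:~R <= t &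
          forall b, t `^ w * `|q%:~R * x b + (p b)%:~R| <= h]].
Proof.
move=> w12 w1 e0.
have [s se] : exists s : nat, 2 `^ (1 - s%:R) <= e.
  have [s sP] := pow2_small (divr_gt0 e0 (ltr0n R 2)); exists s.
  by rewrite addrC -pow2S mulrC -ler_pdivlMr.
(* Truncating and adding 1 puts [(1 - w) * E i.+1] between [E i + s + 1] and [E i + s + 2]; the
   slack only costs a constant factor. *)
have [E EE] := exists_iter
  (fun a => (Num.trunc ((a%:R + s.+1%:R) / (1 - w))).+1).
have trunc_itv a := truncn_itv (x := (a%:R + s.+1%:R) / (1 - w))
  (divr_ge0 (addr_ge0 (ler0n R a) (ler0n R s.+1)) (ltW (etrans (subr_gt0 _ _) w1))).
have Elo i : (E i)%:R + s.+1%:R <= (1 - w) * (E i.+1)%:R.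
  rewrite mulrC -ler_pdivrMr ?subr_gt0// EE.
  by have /andP[_ /ltW] := trunc_itv (E i).
have Ehi i : (1 - w) * (E i.+1)%:R <= (E i)%:R + s.+2%:R.
  rewrite EE; have /andP[+ _] := trunc_itv (E i).
  rewrite ler_pdivlMr ?subr_gt0// -!natr1; lra.
have sS1 : s.+1%:R = s%:R + 1 :> R by rewrite natr1.
have sS2 : s.+2%:R = s%:R + 2 :> R by rewrite -natrD addn2.
(* Since [1 / 2 <= w], the exponents at least double. *)
have E2R i : 2 * ((E i)%:R + s.+1%:R) <= (E i.+1)%:R :> R.
  have := Elo i; have : (0 : R) <= (E i.+1)%:R by []. nra.
have E2 i : (2 * (E i + s.+1) <= E i.+1)%N.
  by rewrite -(ler_nat R) natrM natrD E2R.
have Emono i : (E i < E i.+1)%N by have := E2 i; lia.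
have [x xP] := interleaved_dyadic_series R Emono.
(* At index [i] one series is cut at [i] and the other at [i - 1], so the larger error is governed
   by [E i.+1]. *)
have err i : (0 < i)%N -> exists p : bool -> int, forall b,
    `|(2 ^+ E i)%:~R * x b + (p b)%:~R| <= 2 `^ (1 + (E i)%:R - (E i.+1)%:R).
  case: i => // i _.
  have [r1 _ r1P] := xP i.+1; have [r0 _ r0P] := xP i.
  exists (fun b => if b == odd i then - (r0 * 2 ^+ (E i.+1 - E i))
                   else - (r1 * 2 ^+ (E i.+1 - E i.+1))) => b.
  have bnd j : (i.+2 <= j)%N ->
      2 ^+ E i.+1 * (2 / 2 ^+ E j) <= 2 `^ (1 + (E i.+1)%:R - (E i.+2)%:R) :> R.
    move=> ij; rewrite mulrCA !pow2n pow2V pow2D pow2S; apply: pow2_le.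
    have := exponents_le Emono ij; rewrite -(ler_nat R); lra.
  have [->|nb] := eqVneq b (odd i).
    apply: le_trans (bnd i.+2 _) => //; apply: dyadic_form_upper; first exact: ltnW.
    move: r0P => /andP[h ->]; rewrite andbT; apply: le_trans h.
    by rewrite invr_ge0 exprn_ge0.
  have -> : b = odd i.+1 by move: nb => /=; case: (b); case: (odd i).
  apply: le_trans (bnd i.+3 _) => //; apply: dyadic_form_upper => //.
  move: r1P => /andP[h ->]; rewrite andbT; apply: le_trans h.
  by rewrite invr_ge0 exprn_ge0.
have w0 : 0 <= w by lra.
exists x; split.
- exists (2 ^+ E 1%N) => t /(pow2_bracket Emono)[i i1 /andP[it ti]].
  have [p pP] := err i i1; exists (2 ^+ E i), p; split.
  + by rewrite expf_neq0.
  + by rewrite normrX rmorphXn.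
  + move=> b; apply: le_trans se.
    apply: (@le_trans _ _ ((2 ^+ E i.+1) `^ w * 2 `^ (1 + (E i)%:R - (E i.+1)%:R))).
      apply: ler_pM => //; first exact: powR_ge0.
      apply: ge0_ler_powR => //; rewrite nnegrE ?exprn_ge0//.
      by apply: le_trans it; rewrite exprn_ge0.
    rewrite pow2n -powRrM pow2D; apply: pow2_le.
    have := Elo i; rewrite sS1; lra.
- exists (2 `^ (- s%:R - 4)) => [|t0]; first exact: pow2_gt0.
  have [i0 iP] := pow2_unbounded Emono (2 * t0).
  (* Half a scale: [q] is then smaller than [2 ^ E i.+1], hence not divisible by it. If [2 ^ E i]
     divides [q], the series cut at [i.+1] gives the lower bound; otherwise the one cut at [i]
     does. *)
  pose i := i0; exists (2 ^+ E i.+1 / 2).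
    by rewrite ler_pdivlMr// mulrC iP.
  move=> q p q0 qt.
  have tw : 2 `^ (w * (E i.+1)%:R - 1) <= (2 ^+ E i.+1 / 2) `^ w.
    rewrite -[X in _ / X]powRr1// pow2n pow2V pow2D -powRrM; apply: pow2_le; nra.
  have fin (z v : R) : 2 `^ z <= v -> - s%:R - 4 <= w * (E i.+1)%:R - 1 + z ->
      2 `^ (- s%:R - 4) <= (2 ^+ E i.+1 / 2) `^ w * v.
    move=> zv hz; apply: le_trans (ler_pM _ _ tw zv); rewrite ?powR_ge0//.
    by rewrite pow2D; exact: pow2_le.
  have R0 k : 0 <= (2 ^+ E k : R)^-1 by rewrite invr_ge0 exprn_ge0.
  have := Elo i; have := Ehi i; rewrite sS2 sS1 => Ehi' Elo'.
  have [dv|ndv] := boolP (2 ^+ E i %| q)%Z.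
    have qlt : `|q| < 2 ^+ E i.+1.
      rewrite -(ltr_int R) rmorphXn /=; apply: le_lt_trans qt _.
      by rewrite ltr_pdivrMr// ltr_pMr ?exprn_gt0// ltr1n.
    have [r rodd /andP[h1 h2]] := xP i.+1.
    exists (odd i.+1).
    have := @dyadic_form_lower R (E i.+1) (E i) (x (odd i.+1)) _ r q
      (p (odd i.+1)) rodd _ dv (dyadic_ndvd q0 qlt).
    move=> /(_ (2 / 2 ^+ E i.+3)); rewrite h2 (le_trans (R0 _) h1) => /(_ isT) low.
    apply: (fin ((E i)%:R - (E i.+1)%:R - 1)); last by lra.
    apply: le_trans low.
    rewrite lerBrDr.
    have -> : (2 ^+ E i / 2 ^+ E i.+1 : R) =
      2 `^ ((E i)%:R - (E i.+1)%:R - 1) + 2 `^ ((E i)%:R - (E i.+1)%:R - 1).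
      by rewrite !pow2n pow2V pow2D; exact: pow2_half.
    rewrite lerD2l.
    apply: (@le_trans _ _ (2 ^+ E i.+1 / 2 * (2 / 2 ^+ E i.+3))).
      by rewrite ler_wpM2r// mulr_ge0.
    rewrite mulrA divfK// !pow2n pow2V pow2D; apply: pow2_le.
    have := E2R i.+2; have := E2R i.+1; rewrite sS1.
    have : (0 : R) <= (E i)%:R by []. have : (0 : R) <= (E i.+1)%:R by [].
    have : (0 : R) <= s%:R by []. lra.
  have [r rodd /andP[h1 h2]] := xP i.
  exists (odd i).
  have := @dyadic_form_lower R (E i) 0 (x (odd i)) _ r q (p (odd i)) rodd _ (dvd1z _) ndv.
  move=> /(_ (2 / 2 ^+ E i.+2)); rewrite h2 (le_trans (R0 _) h1) => /(_ isT) low.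
  apply: (fin (- (E i)%:R - 1)); last first.
    have : (0 : R) <= s%:R by []. have : (0 : R) <= (E i.+1)%:R by []. nra.
  apply: le_trans low.
  rewrite lerBrDr.
  have -> : (2 ^+ 0 / 2 ^+ E i : R) = 2 `^ (- (E i)%:R - 1) + 2 `^ (- (E i)%:R - 1).
    by rewrite expr0 mul1r pow2n pow2V; exact: pow2_half.
  rewrite lerD2l.
  apply: (@le_trans _ _ (2 ^+ E i.+1 / 2 * (2 / 2 ^+ E i.+2))).
    by rewrite ler_wpM2r// mulr_ge0.
  rewrite mulrA divfK// !pow2n pow2V pow2D; apply: pow2_le.
  have := E2R i.+1; have := E2R i; rewrite sS1.
  have : (0 : R) <= (E i)%:R by []. have : (0 : R) <= s%:R by []. lra.
- move=> h t0 h0.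
  have [k kP] := pow2_small h0.
  have [i0 iP] := pow2_unbounded Emono t0.
  (* At the start [2 ^ E i] of the range, [t ^ w] is smaller than at its end by the unbounded factor
     [2 ^ (w * (E i.+1 - E i))]; this [i] makes the gain exceed [2 ^ k]. *)
  pose i := (maxn i0 (2 * (k + 1)).+1).
  exists (2 ^+ E i); first by apply: iP; rewrite leq_maxl.
  have i1 : (0 < i)%N by rewrite /i; lia.
  have [p pP] := err i i1; exists (2 ^+ E i), p; split.
  + by rewrite expf_neq0.
  + by rewrite normrX rmorphXn.
  + move=> b; apply: le_trans kP.
    apply: (@le_trans _ _ ((2 ^+ E i) `^ w * 2 `^ (1 + (E i)%:R - (E i.+1)%:R))).
      by apply: ler_pM => //; exact: powR_ge0.
    rewrite pow2n -powRrM pow2D; apply: pow2_le.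
    have iE : (2 * (k%:R + 1) <= (E i)%:R :> R).
      rewrite natr1 -natrM ler_nat; apply: leq_trans (exponents_ge Emono i).
      rewrite /i; lia.
    have := Elo i; rewrite sS1; have : (0 : R) <= s%:R by [].
    have := E2R i; rewrite sS1; nra.
Qed.

(** The integer vector now has one coordinate per series. Putting [2 ^ E i] in the coordinate
    [odd i] and 0 in the other leaves an error of order [2 ^ (E i - E i.+2)], which must do up to
    [t = 2 ^ E i.+1]; this dictates that [E i.+2] be close to [w * E i.+1 + E i + s]. *)
Lemma singular_diagonal (R : realType) (w e : R) : 1 <= w -> 0 < e ->
  exists x : bool -> R,
  [/\ exists t0, forall t, t0 <= t -> exists y p : bool -> int,
        [/\ exists b, y b != 0, forall b, `|y b|%:~R <= t &
          forall b, t `^ w * `|(y b)%:~R * x b + (p b)%:~R| <= e],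
      exists2 c, 0 < c & forall t0, exists2 t, t0 <= t &
        forall y p : bool -> int,
          (exists b, y b != 0) -> (forall b, `|y b|%:~R <= t) ->
          exists b, c <= t `^ w * `|(y b)%:~R * x b + (p b)%:~R|
    & forall h t0, 0 < h -> exists2 t, t0 <= t & exists y p : bool -> int,
        [/\ exists b, y b != 0, forall b, `|y b|%:~R <= t &
          forall b, t `^ w * `|(y b)%:~R * x b + (p b)%:~R| <= h]].
Proof.
move=> w1 e0; have w0 : 0 <= w by lra.
have [s se] := pow2_small e0.
have [E [E0 E1 EE]] := exists_iter2
  (fun a b => ((Num.trunc (w * b%:R)).+1 + a + s.+1)%N).
have sS1 : s.+1%:R = s%:R + 1 :> R by rewrite natr1.
have trunc_itv a := truncn_itv (mulr_ge0 w0 (ler0n R a)).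
have Elo i : w * (E i.+1)%:R + (E i)%:R + s%:R + 1 <= (E i.+2)%:R.
  rewrite EE !natrD sS1; have /andP[_ /ltW] := trunc_itv (E i.+1); lra.
have Ehi i : (E i.+2)%:R <= w * (E i.+1)%:R + (E i)%:R + s%:R + 2.
  rewrite EE !natrD sS1 -addn1 natrD; have /andP[+ _] := trunc_itv (E i.+1); lra.
have E_ge0 i : (0 : R) <= (E i)%:R by [].
have s_ge0 : (0 : R) <= s%:R by [].
have ED i : (E i)%:R + (E i.+1)%:R + 1 <= (E i.+2)%:R :> R.
  by have := Elo i; have := E_ge0 i.+1; nra.
have Emono i : (E i < E i.+1)%N.
  case: i => [|i]; first by rewrite E0 E1.
  have := ED i; rewrite -natrD natr1 ler_nat; lia.
have [x xP] := interleaved_dyadic_series R Emono.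
have R0 k : 0 <= (2 ^+ E k : R)^-1 by rewrite invr_ge0 exprn_ge0.
have err i : exists y p : bool -> int,
  [/\ exists b, y b != 0, forall b, `|y b|%:~R <= 2 ^+ E i :> R &
    forall b, `|(y b)%:~R * x b + (p b)%:~R| <= 2 `^ (1 + (E i)%:R - (E i.+2)%:R)].
  have [r _ rP] := xP i.
  exists (fun b => if b == odd i then 2 ^+ E i else 0).
  exists (fun b => if b == odd i then - (r * 2 ^+ (E i - E i)) else 0); split.
  - by exists (odd i); rewrite eqxx expf_neq0.
  - move=> b; case: ifP => _; first by rewrite normrX rmorphXn.
    by rewrite normr0 exprn_ge0.
  - move=> b; case: eqP => [->|_]; last by rewrite mul0r add0r normr0 powR_ge0.
    have -> : 2 `^ (1 + (E i)%:R - (E i.+2)%:R) = 2 ^+ E i * (2 / 2 ^+ E i.+2) :> R.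
      by rewrite mulrCA !pow2n pow2V pow2D pow2S; congr (_ `^ _); ring.
    apply: dyadic_form_upper => //.
    by move: rP => /andP[h ->]; rewrite andbT; apply: le_trans h.
exists x; split.
- exists (2 ^+ E 0%N) => t /(pow2_bracket Emono)[i _ /andP[it ti]].
  have [y [p [y0 yt yp]]] := err i; exists y, p; split=> // b.
    exact: le_trans it.
  apply: le_trans se.
  apply: (@le_trans _ _ ((2 ^+ E i.+1) `^ w * 2 `^ (1 + (E i)%:R - (E i.+2)%:R))).
    apply: ler_pM => //; first exact: powR_ge0.
    apply: ge0_ler_powR => //; rewrite nnegrE ?exprn_ge0//.
    by apply: le_trans it; rewrite exprn_ge0.
  rewrite pow2n -powRrM pow2D; apply: pow2_le.
  by have := Elo i; lra.
(* Just below scale [i.+1], a nonzero coordinate [odd i.+1] is not divisible by [2 ^ E i.+1], so its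
   form is of order at least [2 ^ - E i.+1], which suffices as [1 <= w]. Otherwise the other
   coordinate is nonzero; its worst case is a multiple of [2 ^ E i], with a value of order
   [2 ^ (E i - E i.+2)], and there the upper bound on [E i.+2] decides. *)
- exists (2 `^ (- w - s%:R - 2)) => [|t0]; first exact: pow2_gt0.
  have [i iP] := pow2_unbounded Emono (2 * t0).
  exists (2 ^+ E i.+1 / 2); first by rewrite ler_pdivlMr// mulrC iP.
  move=> y p y0 yt.
  have tw : 2 `^ (w * (E i.+1)%:R - w) <= (2 ^+ E i.+1 / 2) `^ w.
    rewrite -[X in _ / X]powRr1// pow2n pow2V pow2D -powRrM; apply: pow2_le; nra.
  have fin (z v : R) : 2 `^ z <= v -> - s%:R - 2 <= w * (E i.+1)%:R + z ->
      2 `^ (- w - s%:R - 2) <= (2 ^+ E i.+1 / 2) `^ w * v.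
    move=> zv hz; apply: le_trans (ler_pM _ _ tw zv); rewrite ?powR_ge0//.
    by rewrite pow2D; apply: pow2_le; lra.
  have nz j k b z : (E j)%:R + (E i.+1)%:R + 1 <= (E k)%:R :> R -> (j <= i.+1)%N ->
      2 ^+ 0 / 2 ^+ E j - `|y b|%:~R * (2 / 2 ^+ E k) <= z ->
      2 `^ (- w - s%:R - 2) <= (2 ^+ E i.+1 / 2) `^ w * z.
    move=> jk ji h; apply: (fin (- (E j)%:R - 1)); last first.
      have := E_ge0 i.+1; have := exponents_le Emono ji; rewrite -(ler_nat R); nra.
    apply: le_trans h; rewrite lerBrDr expr0 mul1r [X in _ <= X^-1]pow2n pow2V.
    rewrite [leRHS]pow2_half lerD2l.
    apply: (@le_trans _ _ (2 ^+ E i.+1 / 2 * (2 / 2 ^+ E k))).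
      by rewrite ler_wpM2r// mulr_ge0.
    rewrite mulrA divfK// !pow2n pow2V pow2D; apply: pow2_le; lra.
  have [r1 odd1 /andP[l1 u1]] := xP i.+1.
  have [r0 odd0 /andP[l0 u0]] := xP i.
  have [y1|y1] := eqVneq (y (odd i.+1)) 0; last first.
    have ylt : `|y (odd i.+1)| < 2 ^+ E i.+1.
      rewrite -(ltr_int R) rmorphXn /=; apply: le_lt_trans (yt _) _.
      by rewrite ltr_pdivrMr// ltr_pMr ?exprn_gt0// ltr1n.
    exists (odd i.+1).
    have := @dyadic_form_lower R (E i.+1) 0 (x (odd i.+1)) _ r1 _
      (p (odd i.+1)) odd1 _ (dvd1z _) (dyadic_ndvd y1 ylt).
    move=> /(_ (2 / 2 ^+ E i.+3)); rewrite u1 (le_trans (R0 _) l1) => /(_ isT).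
    apply: nz => //; have := ED i.+1; have := ED i; have := E_ge0 i; lra.
  have {y1}y0 : y (odd i) != 0.
    case: y0 => b; have [->//|] := eqVneq b (odd i).
    move: y1 => /=; case: b; case: (odd i) => //= ->; by rewrite eqxx.
  exists (odd i).
  have jk : (E i)%:R + (E i.+1)%:R + 1 <= (E i.+2)%:R :> R by exact: ED.
  have [dv|ndv] := boolP (2 ^+ E i %| y (odd i))%Z; last first.
    have := @dyadic_form_lower R (E i) 0 (x (odd i)) _ r0 _ (p (odd i))
      odd0 _ (dvd1z _) ndv.
    move=> /(_ (2 / 2 ^+ E i.+2)); rewrite u0 (le_trans (R0 _) l0) => /(_ isT).
    exact: nz.
  have := @dyadic_form_lower_dvd R (E i) (x (odd i)) _ _ r0 _
    (p (odd i)) odd0 (R0 i.+2) _ y0 dv.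
  move=> /(_ (2 / 2 ^+ E i.+2)); rewrite u0 l0 => /(_ isT)[|low].
    by rewrite -[X in X - _]mul1r -[X in X / _ - _](expr0 2); exact: nz.
  apply: (fin ((E i)%:R - (E i.+2)%:R)); last by have := Ehi i; lra.
  by apply: le_trans low; rewrite !pow2n pow2V pow2D.
- move=> h t0 h0.
  have [k kP] := pow2_small h0.
  have [i0 iP] := pow2_unbounded Emono t0.
  pose i := (i0 + k)%N.
  exists (2 ^+ E i.+1); first by apply: iP; rewrite /i; lia.
  have [y [p [y0 yt yp]]] := err i.+1; exists y, p; split=> // b.
  apply: le_trans kP.
  apply: (@le_trans _ _ ((2 ^+ E i.+1) `^ w * 2 `^ (1 + (E i.+1)%:R - (E i.+3)%:R))).
    by apply: ler_pM => //; exact: powR_ge0.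
  rewrite pow2n -powRrM pow2D; apply: pow2_le.
  have : k%:R <= (E i)%:R :> R.
    by rewrite ler_nat; apply: leq_trans (exponents_ge Emono i); rewrite /i; lia.
  move=> kE; have gap := ED i; have := Elo i.+1.
  have Ei := E_ge0 i.
  (* By [1 <= w] the exponent is lowered by at least [E i.+2 - E i.+1], which exceeds [E i]. *)
  have : 0 <= (w - 1) * ((E i.+2)%:R - (E i.+1)%:R) by apply: mulr_ge0; lra.
  by lra.
Qed.

(** Thue's lemma for a box: among the [T.+1 * Y.+1] pairs, two give values congruent modulo [K], and
    their difference is the solution. *)
Lemma pigeonhole_congruence (K T Y : nat) (u v : int) :
    (0 < K)%N -> (K < T.+1 * Y.+1)%N ->
  exists y z : int, [/\ (y != 0) || (z != 0), `|y| <= T%:Z, `|z| <= Y%:Z &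
    (K%:Z %| y * u + z * v)%Z].
Proof.
case: K => // K _ KTY.
pose f (a : 'I_T.+1 * 'I_Y.+1) : 'I_K.+1 :=
  inord `|((a.1%:Z * u + a.2%:Z * v)%R %% K.+1%:Z)%Z|%N.
have : ~~ injectiveb f.
  apply/negP => /injectiveP/leq_card; rewrite card_prod !card_ord leqNgt.
  by rewrite KTY.
case/injectivePn => a [b ab fab].
exists (a.1%:Z - b.1%:Z), (a.2%:Z - b.2%:Z); split.
- apply: contraR ab; rewrite negb_or !negbK !subr_eq0 !eqz_nat.
  by case: a b {fab} => [a1 a2] [b1 b2] /= /andP[/eqP/val_inj-> /eqP/val_inj->].
- by have := ltn_ord a.1; have := ltn_ord b.1; lia.
- by have := ltn_ord a.2; have := ltn_ord b.2; lia.
- have {}fab : ((a.1%:Z * u + a.2%:Z * v) = (b.1%:Z * u + b.2%:Z * v) %[mod K.+1%:Z])%Z.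
    have lt (c : int) : (`|(c %% K.+1%:Z)%Z|%N < K.+1)%N.
      by rewrite -ltz_nat gez0_abs ?modz_ge0// ltz_pmod.
    move/(congr1 (@nat_of_ord _)): fab; rewrite /f !inordK ?lt// => /(congr1 Posz).
    by rewrite !gez0_abs ?modz_ge0.
  rewrite (_ : _ + _ = (a.1%:Z * u + a.2%:Z * v) - (b.1%:Z * u + b.2%:Z * v));
    last by ring.
  by rewrite -eqz_mod_dvd; apply/eqP.
Qed.

(** A multiple of a single coordinate is good enough only on the first part of the range up to
    [2 ^ E i.+1]. On the rest both coordinates are needed: the pigeonhole principle annuls the
    rational part of the form, and only the tails of the series remain. *)
Lemma singular_linear_form (R : realType) (e : R) : 0 < e ->
  exists x : bool -> R,
  [/\ exists t0, forall t, t0 <= t -> exists (y : bool -> int) (p : int),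
        [/\ exists b, y b != 0, forall b, `|y b|%:~R <= t &
          t ^+ 2 * `|(y false)%:~R * x false + (y true)%:~R * x true + p%:~R| <= e],
      exists2 c, 0 < c & forall t0, exists2 t, t0 <= t &
        forall (y : bool -> int) (p : int),
          (exists b, y b != 0) -> (forall b, `|y b|%:~R <= t) ->
          c <= t ^+ 2 * `|(y false)%:~R * x false + (y true)%:~R * x true + p%:~R|
    & forall h t0, 0 < h -> exists2 t, t0 <= t &
        exists (y : bool -> int) (p : int),
        [/\ exists b, y b != 0, forall b, `|y b|%:~R <= t &
          t ^+ 2 * `|(y false)%:~R * x false + (y true)%:~R * x true + p%:~R| <= h]].
Proof.
move=> e0.
have [s se] : exists s : nat, 2 `^ (1 - 2 * s%:R) <= e.
  have [s sP] := pow2_small (divr_gt0 e0 (ltr0n R 2)); exists s.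
  apply: (@le_trans _ _ (2 `^ (- s%:R + 1))).
    by apply: pow2_le; have : (0 : R) <= s%:R by []; lra.
  by rewrite -pow2S mulrC -ler_pdivlMr.
have [E EE] := exists_iter (fun a => 2 * (a + s.+1))%N.
have sS1 : s.+1%:R = s%:R + 1 :> R by rewrite natr1.
have ER i : (E i.+1)%:R = 2 * ((E i)%:R + (s%:R + 1)) :> R.
  by rewrite EE natrM natrD sS1.
have E_ge0 i : (0 : R) <= (E i)%:R by [].
have s_ge0 : (0 : R) <= s%:R by [].
have Emono i : (E i < E i.+1)%N by rewrite EE; lia.
have [x xP] := interleaved_dyadic_series R Emono.
have R0 k : 0 <= (2 ^+ E k : R)^-1 by rewrite invr_ge0 exprn_ge0.
have parity i (y : bool -> int) (p : R) :
    (y false)%:~R * x false + (y true)%:~R * x true + p =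
    (y (odd i.+1))%:~R * x (odd i.+1) + (y (odd i))%:~R * x (odd i) + p :> R.
  by rewrite /=; case: (odd i) => //=; congr (_ + p); exact: addrC.
have small i : exists (y : bool -> int) (p : int),
  [/\ exists b, y b != 0, forall b, `|y b|%:~R <= 2 ^+ E i :> R &
    `|(y false)%:~R * x false + (y true)%:~R * x true + p%:~R|
       <= 2 `^ (1 + (E i)%:R - (E i.+2)%:R)].
  have [r _ rP] := xP i.
  pose y b : int := if b == odd i then 2 ^+ E i else 0.
  exists y, (- (r * 2 ^+ (E i - E i))); split.
  - by exists (odd i); rewrite /y eqxx expf_neq0.
  - move=> b; rewrite /y; case: ifP => _; first by rewrite normrX rmorphXn.
    by rewrite normr0 exprn_ge0.
  - rewrite (parity i) /y eqxx (_ : (odd i.+1 == odd i) = false);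
    last by rewrite /=; case: (odd i).
    have -> : 2 `^ (1 + (E i)%:R - (E i.+2)%:R) = 2 ^+ E i * (2 / 2 ^+ E i.+2) :> R.
      by rewrite mulrCA !pow2n pow2V pow2D pow2S; congr (_ `^ _); ring.
    rewrite mul0r add0r; apply: dyadic_form_upper => //.
    by move: rP => /andP[h ->]; rewrite andbT; apply: le_trans h.
(* The form is split into a fraction with denominator [2 ^ E i.+1] and a combination of the two
   tails; what follows turns on whether the numerator vanishes. *)
have main i (y1 y0 r1 r0 p : int) (x1 x0 : R) :
    y1%:~R * x1 + y0%:~R * x0 + p%:~R =
    (y1 * r1 + y0 * (r0 * 2 ^+ (E i.+1 - E i)) + p * 2 ^+ E i.+1)%:~R / 2 ^+ E i.+1
    + (y1%:~R * (x1 - r1%:~R / 2 ^+ E i.+1) + y0%:~R * (x0 - r0%:~R / 2 ^+ E i)).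
  rewrite !(rmorphD, rmorphM, rmorphXn) /=.
  move: (E i.+1 - E i)%N (subnK (ltnW (Emono i))) => d <-; rewrite exprD; field.
  by rewrite !gt_eqF// exprn_gt0.
exists x; split.
- exists (2 ^+ E 0%N) => t /(pow2_bracket Emono)[i _ /andP[it ti]].
  have t0 : 0 <= t by apply: le_trans it; rewrite exprn_ge0.
  (* Beyond this threshold [4 * K <= t ^ 2] for [K = 2 ^ E i.+1], which is what the pigeonhole
     argument asks for; up to it, one coordinate is enough. *)
  have [ts|ts] := leP t (2 `^ (s.+1%:R + 1 + (E i)%:R)).
    have [y [p [y0 yt yp]]] := small i; exists y, p; split=> //.
      by move=> b; exact: le_trans it.
    apply: le_trans se.
    apply: (@le_trans _ _ ((2 `^ (s.+1%:R + 1 + (E i)%:R)) ^+ 2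
                       * 2 `^ (1 + (E i)%:R - (E i.+2)%:R))).
      by apply: ler_pM => //; rewrite ?exprn_ge0// lerXn2r// nnegrE powR_ge0.
    rewrite expr2 !pow2D; apply: pow2_le; rewrite !ER sS1.
    have := E_ge0 i; lra.
  have [r1 odd1 /andP[l1 u1]] := xP i.+1.
  have [r0 odd0 /andP[l0 u0]] := xP i.
  have t2 : 2 <= t.
    apply: le_trans (ltW ts); rewrite -[leLHS]powRr1//; apply: pow2_le.
    by have := E_ge0 i; rewrite sS1; lra.
  pose T := Num.trunc t.
  have /andP[Tt tT] : T%:R <= t < T%:R + 1 by rewrite natr1; exact: truncn_itv.
  have T0 : (0 < T)%N by rewrite -(ltr_nat R); lra.
  (* With [y] up to [T], the other unknown can be kept below about [K / t], which is at most [t]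
     because [4 * K <= t ^ 2]. *)
  pose K := (2 ^ E i.+1)%N; pose Y := (K %/ T)%N.
  have KE : K%:R = 2 ^+ E i.+1 :> R by rewrite natrX.
  have KTY : (K < T.+1 * Y.+1)%N.
    have := ltn_ceil K T0; rewrite -/Y; rewrite mulnC => /leq_trans; apply.
    by rewrite leq_mul2r leqnSn orbT.
  have K0 : (0 < K)%N by rewrite expn_gt0.
  have [y [z [yz yT zY /dvdzP[q qE]]]] :=
    pigeonhole_congruence r1 (r0 * 2 ^+ (E i.+1 - E i)) K0 KTY.
  have YTK : Y%:R * T%:R <= K%:R :> R.
    by rewrite -natrM ler_nat; exact: leq_trunc_div.
  have YtK : Y%:R * t <= 2 * K%:R.
    have : 0 <= Y%:R :> R by []; nra.
  have tK : 4 * K%:R <= t ^+ 2.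
    apply: (@le_trans _ _ ((2 `^ (s.+1%:R + 1 + (E i)%:R)) ^+ 2)); last first.
      by rewrite lerXn2r ?nnegrE ?powR_ge0// ltW.
    rewrite KE (_ : 4 = 2 ^+ 2)%R; last by rewrite expr2; ring.
    by rewrite !pow2n expr2 !pow2D; apply: pow2_le; rewrite ER sS1; lra.
  have Yt : Y%:R <= t.
    rewrite leNgt; apply/negP => tY.
    have := YtK; rewrite expr2 in tK; nra.
  have yT' : `|y|%:~R <= t by apply: le_trans Tt; rewrite [leRHS]pmulrn ler_int.
  have zY' : `|z|%:~R <= Y%:R :> R by rewrite [leRHS]pmulrn ler_int.
  pose yz' b := if b == odd i then z else y.
  exists yz', (- q); split.
  + case/orP: yz => yz; [exists (~~ odd i)|exists (odd i)]; rewrite /yz' ?eqxx//.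
    by case: (odd i).
  + by move=> b; rewrite /yz'; case: ifP => _ //; exact: le_trans Yt.
  rewrite (parity i) /yz' eqxx (_ : (odd i.+1 == odd i) = false);
    last by rewrite /=; case: (odd i).
  rewrite (main i _ _ r1 r0) qE.
  have -> : q * K%:Z + - q * 2 ^+ E i.+1 = 0.
    by rewrite /K -natz natrX mulNr subrr.
  rewrite mul0r add0r.
  have b1 : `|y%:~R * (x (odd i.+1) - r1%:~R / 2 ^+ E i.+1)| <= t * (2 / 2 ^+ E i.+3).
    rewrite normrM -intr_norm; apply: ler_pM => //.
    by rewrite ger0_norm// (le_trans _ l1).
  have b0 : `|z%:~R * (x (odd i) - r0%:~R / 2 ^+ E i)| <= Y%:R * (2 / 2 ^+ E i.+2).
    rewrite normrM -intr_norm; apply: ler_pM => //.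
    by rewrite ger0_norm// (le_trans _ l0).
  apply: le_trans (ler_wpM2l _ (le_trans (ler_normD _ _) (lerD b1 b0))) _.
    by rewrite exprn_ge0.
  apply: le_trans se.
  have tK1 : t <= K%:R by rewrite KE.
  rewrite mulrDr.
  have c1 : t ^+ 2 * (t * (2 / 2 ^+ E i.+3)) <= 2 `^ (1 - 2 * s%:R - 1).
    apply: (@le_trans _ _ ((2 ^+ E i.+1) ^+ 2 * (2 ^+ E i.+1 * (2 / 2 ^+ E i.+3)))).
      apply: ler_pM; rewrite ?exprn_ge0 ?mulr_ge0// ?lerXn2r ?nnegrE ?exprn_ge0//.
      by rewrite ler_wpM2r// mulr_ge0.
    rewrite mulrCA 2!(mulrCA _ 2) expr2 !pow2n pow2V !pow2D pow2S; apply: pow2_le.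
    by rewrite !ER; have := E_ge0 i; lra.
  have c0 : t ^+ 2 * (Y%:R * (2 / 2 ^+ E i.+2)) <= 2 `^ (1 - 2 * s%:R - 1).
    apply: (@le_trans _ _ (2 * K%:R * K%:R * (2 / 2 ^+ E i.+2))).
      rewrite [leLHS]mulrA; apply: ler_wpM2r; first by rewrite mulr_ge0.
      rewrite expr2 -mulrA (mulrC t Y%:R) [leLHS]mulrC.
      by apply: ler_pM => //; rewrite mulr_ge0.
    rewrite KE -!mulrA 2!(mulrCA _ 2) !pow2n pow2V !pow2D !pow2S; apply: pow2_le.
    by rewrite !ER; have := E_ge0 i; lra.
  by apply: le_trans (lerD c1 c0) _; rewrite -pow2_half.
(* If the numerator is nonzero, the form is at least [2 ^ - E i.+1] up to smaller tails. If it
   vanishes, the coefficient of parity [odd i] is nonzero, and its tail term, at least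
   [2 ^ - E i.+2], dominates the other one. *)
- exists (2 `^ (- 5 - 2 * s%:R)) => [|t0]; first exact: pow2_gt0.
  have [i iP] := pow2_unbounded Emono (2 * t0).
  exists (2 ^+ E i.+1 / 2); first by rewrite ler_pdivlMr// mulrC iP.
  move=> y p y0 yt; rewrite (parity i).
  have [r1 odd1 /andP[l1 u1]] := xP i.+1.
  have [r0 odd0 /andP[l0 u0]] := xP i.
  have th1 := le_trans (R0 _) l1; have th0 := le_trans (R0 _) l0.
  have t2 : (2 ^+ E i.+1 / 2) ^+ 2 = 2 `^ (2 * (E i.+1)%:R - 2) :> R.
    rewrite -[X in _ / X]powRr1// expr2 !pow2n !pow2V !pow2D.
    by congr (_ `^ _); ring.
  have fin (z v : R) : 2 `^ z <= v -> - 3 - 2 * s%:R <= 2 * (E i.+1)%:R + z ->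
      2 `^ (- 5 - 2 * s%:R) <= (2 ^+ E i.+1 / 2) ^+ 2 * v.
    move=> zv hz; rewrite t2; apply: le_trans (ler_pM _ _ (lexx _) zv);
      rewrite ?powR_ge0//.
    by rewrite pow2D; apply: pow2_le; lra.
  rewrite (main i _ _ r1 r0).
  set N := (X in X%:~R).
  have b1 : `|(y (odd i.+1))%:~R * (x (odd i.+1) - r1%:~R / 2 ^+ E i.+1)| <=
      2 `^ ((E i.+1)%:R - (E i.+3)%:R).
    rewrite normrM -intr_norm (ger0_norm th1).
    apply: le_trans (ler_pM _ th1 (yt _) u1) _ => //.
    by rewrite mulrA divfK// !pow2n pow2V pow2D.
  have [N0|N0] := eqVneq N 0; last first.
    apply: (fin (- (E i.+1)%:R - 1)); last by have := E_ge0 i.+1; lra.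
    have b0 : `|(y (odd i))%:~R * (x (odd i) - r0%:~R / 2 ^+ E i)| <=
        2 `^ ((E i.+1)%:R - (E i.+2)%:R).
      rewrite normrM -intr_norm (ger0_norm th0).
      apply: le_trans (ler_pM _ th0 (yt _) u0) _ => //.
      by rewrite mulrA divfK// !pow2n pow2V pow2D.
    apply: le_trans (lerB_normD _ _).
    have n0 : 2 `^ (- (E i.+1)%:R) <= `|N%:~R / 2 ^+ E i.+1| :> R.
      rewrite normrM (ger0_norm (R0 _)) pow2n pow2V ler_peMl ?powR_ge0//.
      by rewrite -intr_norm ler1z -gtz0_ge1 normr_gt0.
    rewrite pow2_half in n0.
    have d1 : 2 `^ ((E i.+1)%:R - (E i.+3)%:R) <= 2 `^ (- (E i.+1)%:R - 1 - 1) :> R.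
      by apply: pow2_le; rewrite !ER; have := E_ge0 i; lra.
    have d0 : 2 `^ ((E i.+1)%:R - (E i.+2)%:R) <= 2 `^ (- (E i.+1)%:R - 1 - 1) :> R.
      by apply: pow2_le; rewrite !ER; have := E_ge0 i; lra.
    have := pow2_half (- (E i.+1)%:R - 1 : R).
    have := le_trans (ler_normD _ _) (lerD b1 b0); lra.
  (* Otherwise [2 ^ E i.+1] would divide [y (odd i.+1) * r1] and, [r1] being odd, the nonzero
     [y (odd i.+1)], which is too small for that. *)
  have yz0 : y (odd i) != 0.
    apply/eqP => z0; have [b yb] := y0.
    have {b yb}y1 : y (odd i.+1) != 0.
      move: yb z0 => /=; case: b; case: (odd i) => //= yb z0; by rewrite z0 eqxx in yb.
    have ylt : `|y (odd i.+1)| < 2 ^+ E i.+1.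
      rewrite -(ltr_int R) rmorphXn /=; apply: le_lt_trans (yt _) _.
      by rewrite ltr_pdivrMr// ltr_pMr ?exprn_gt0// ltr1n.
    move: (dyadic_ndvd y1 ylt); rewrite -(Gauss_dvdzl _ (odd1 _)).
    move: N0; rewrite /N z0 mul0r addr0 => /eqP; rewrite addr_eq0 => /eqP->.
    by rewrite -mulNr dvdz_mull.
  rewrite N0 mul0r add0r.
  apply: (fin (- (E i.+2)%:R - 1)); last by rewrite !ER; lra.
  rewrite [X in `|X|]addrC.
  apply: le_trans (lerB_normD _ _).
  have n0 : 2 `^ (- (E i.+2)%:R) <=
      `|(y (odd i))%:~R * (x (odd i) - r0%:~R / 2 ^+ E i)|.
    rewrite normrM (ger0_norm th0); apply: le_trans (ler_peMl th0 _).
      by rewrite -pow2V -pow2n.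
    by rewrite -intr_norm ler1z -gtz0_ge1 normr_gt0.
  rewrite pow2_half in n0.
  have d1 : 2 `^ ((E i.+1)%:R - (E i.+3)%:R) <= 2 `^ (- (E i.+2)%:R - 1) :> R.
    by apply: pow2_le; rewrite !ER; have := E_ge0 i; lra.
  lra.
- move=> h t0 h0.
  have [k kP] := pow2_small h0.
  have [i0 iP] := pow2_unbounded Emono t0.
  pose i := (i0 + k)%N.
  exists (2 ^+ E i); first by apply: iP; rewrite /i; lia.
  have [y [p [y0 yt yp]]] := small i; exists y, p; split=> //.
  apply: le_trans kP.
  apply: (@le_trans _ _ ((2 ^+ E i) ^+ 2 * 2 `^ (1 + (E i)%:R - (E i.+2)%:R))).
    by apply: ler_pM => //; rewrite exprn_ge0// exprn_ge0.
  rewrite expr2 pow2n !pow2D; apply: pow2_le.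
  have : k%:R <= (E i)%:R :> R.
    by rewrite ler_nat; apply: leq_trans (exponents_ge Emono i); rewrite /i; lia.
  by rewrite !ER; lra.
Qed.

(** * Singular blocks *)

Lemma mx_norm_coord (R : realType) (m n : nat) (v : 'M[R]_(m, n)) i j :
  `|v i j| <= `|v|.
Proof.
rewrite [leRHS]mx_normrE.
by apply: (le_bigmax _ (fun ij : 'I_m * 'I_n => `|v ij.1 ij.2|) (i, j)).
Qed.

Lemma mx_norm_le (R : realType) (m n : nat) (v : 'M[R]_(m, n)) (r : R) :
  0 <= r -> (forall i j, `|v i j| <= r) -> `|v| <= r.
Proof. by move=> r0 vr; rewrite [leLHS]mx_normrE; apply: bigmax_le => // i _. Qed.

Section SingularBlock.
Variable R : realType.

Definition intmx m n (b : 'M[int]_(m, n)) : 'M[R]_(m, n) := map_mx intr b.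

Definition err m k (A : 'M[R]_(m, k)) (b : 'cV[int]_k) (b' : 'cV[int]_m) : R :=
  `|A *m intmx b + intmx b'|.

Lemma err_ge0 m k (A : 'M[R]_(m, k)) b b' : 0 <= err A b b'.
Proof. exact: normr_ge0. Qed.

(** The inequality [t ^ w * psi t <= e] for the maximum norm, freed of the infimum; for an integer
    vector, [b != 0] means norm at least 1. *)
Definition small_at m k (A : 'M[R]_(m, k)) (w e t : R) : Prop :=
  exists b b', [/\ b != 0, `|intmx b| <= t & t `^ w * err A b b' <= e].

Definition large_at m k (A : 'M[R]_(m, k)) (w c t : R) : Prop :=
  forall b b', b != 0 -> `|intmx b| <= t -> c <= t `^ w * err A b b'.

Definition singular_block m k (A : 'M[R]_(m, k)) (w e : R) : Prop :=
  [/\ exists t0, forall t, t0 <= t -> small_at A w e t,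
      exists2 c, 0 < c & forall t0, exists2 t, t0 <= t & large_at A w c t
    & forall h t0, 0 < h -> exists2 t, t0 <= t & small_at A w h t].

Lemma intmx_neq0 m n (b : 'M[int]_(m, n)) : b != 0 -> exists i j, b i j != 0.
Proof.
move=> b0; apply: contrapT => /forallNP nb; move: b0; apply/negP; rewrite negbK.
apply/eqP/matrixP => i j; rewrite mxE; apply/eqP; apply: contrapT => bij.
by apply: (nb i); exists j; apply/negP.
Qed.

(** Parity identifies ['I_2] with [bool], the index type of the pairs of series. *)
Lemma col_of_bool (y : bool -> int) (b : bool) :
  (\col_(j < 2) y (odd j)) (inord b) 0 = y b.
Proof. by rewrite mxE inordK; case: b. Qed.

Lemma singular_block_column m (w e : R) : (1 < m)%N ->
  1 / 2 <= w -> w < 1 -> 0 < e -> exists A : 'M[R]_(m, 1), singular_block A w e.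
Proof.
move=> m1 w12 w1 e0; have [x [U [c c0 L] Z]] := singular_column w12 w1 e0.
pose A : 'M[R]_(m, 1) := \matrix_(i, j) (if (i < 2)%N then x (odd i) else 0).
have AE i b b' : (A *m intmx b + intmx b') i 0 =
    (if (i < 2)%N then x (odd i) else 0) * (b 0 0)%:~R + (b' i 0)%:~R.
  by rewrite !mxE big_ord1 !mxE.
have up t h : 0 <= h -> (exists (q : int) (p : bool -> int),
      [/\ q != 0, `|q|%:~R <= t &
       forall b, t `^ w * `|q%:~R * x b + (p b)%:~R| <= h]) -> small_at A w h t.
  move=> h0 [q [p [q0 qt qp]]].
  exists (const_mx q), (\col_i if (i < 2)%N then p (odd i) else 0); split.
  - by apply: contra_neq q0 => /matrixP/(_ 0 0); rewrite !mxE.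
  - apply: mx_norm_le => [|i j]; first exact: le_trans qt.
    by rewrite !mxE -intr_norm.
  - have [t0|t0] := leP (t `^ w) 0.
      by apply: le_trans h0; apply: mulr_le0_ge0 => //; exact: err_ge0.
    rewrite [leLHS]mulrC -ler_pdivlMr// /err; apply: mx_norm_le => [|i j].
      by rewrite divr_ge0// ltW.
    rewrite ord1 AE !mxE ler_pdivlMr// [leLHS]mulrC; case: ifP => _.
      by rewrite [_ * q%:~R]mulrC.
    by rewrite mul0r addr0 normr0 mulr0.
exists A; split.
- have [t0 tU] := U; exists t0 => t /tU; apply: up; exact: ltW.
- exists c => // t0; have [t tt0 tL] := L t0; exists t => // b b' b0 bt.
  have q0 : b 0 0 != 0 by have [i [j]] := intmx_neq0 b0; rewrite !ord1.
  have qt : `|b 0 0|%:~R <= t.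
    by apply: le_trans bt; have := mx_norm_coord (intmx b) 0 0; rewrite !mxE intr_norm.
  pose i (a : bool) : 'I_m := Ordinal (leq_ltn_trans (leq_b1 a) m1).
  have [a /le_trans] := tL (b 0 0) (fun a => b' (i a) 0) q0 qt; apply.
  apply: ler_wpM2l; first exact: powR_ge0.
  have := mx_norm_coord (A *m intmx b + intmx b') (i a) 0; rewrite AE /=.
  by rewrite (leq_ltn_trans (leq_b1 a)) // mulrC; case: a.
- move=> h t0 h0; have [t tt0 tZ] := Z h t0 h0; exists t => //; apply: up => //.
  exact: ltW.
Qed.

Lemma singular_block_diagonal m (w e : R) : (1 < m)%N ->
  1 <= w -> 0 < e -> exists A : 'M[R]_(m, 2), singular_block A w e.
Proof.
move=> m1 w1 e0; have [x [U [c c0 L] Z]] := singular_diagonal w1 e0.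
pose A : 'M[R]_(m, 2) := \matrix_(i, j) (if i == j :> nat then x (odd j) else 0).
have AE i b b' : (A *m intmx b + intmx b') i 0 =
    (if (i < 2)%N then (b (inord (odd i)) 0)%:~R * x (odd i) else 0) + (b' i 0)%:~R.
  rewrite !mxE big_ord_recl big_ord1 !mxE /=; congr (_ + _).
  case: i => [[|[|i]] im] /=.
  - rewrite mul0r addr0 mulrC; congr (_%:~R * _); congr (b _ _).
    by apply: val_inj; rewrite /= inordK.
  - rewrite mul0r add0r mulrC; congr (_%:~R * _); congr (b _ _).
    by apply: val_inj; rewrite /= inordK.
  - by rewrite !mul0r addr0.
have up t h : 0 <= h -> (exists y p : bool -> int,
        [/\ exists b, y b != 0, forall b, `|y b|%:~R <= t &
          forall b, t `^ w * `|(y b)%:~R * x b + (p b)%:~R| <= h]) ->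
    small_at A w h t.
  move=> h0 [y [p [[b0 yb0] yt yp]]].
  exists (\col_(j < 2) y (odd j)), (\col_i if (i < 2)%N then p (odd i) else 0); split.
  - apply: contra_neq yb0 => /matrixP/(_ (inord b0) 0).
    by rewrite col_of_bool mxE.
  - apply: mx_norm_le => [|i j]; first exact: le_trans (yt true).
    by rewrite !mxE -intr_norm.
  - have [t0|t0] := leP (t `^ w) 0.
      by apply: le_trans h0; apply: mulr_le0_ge0 => //; exact: err_ge0.
    rewrite [leLHS]mulrC -ler_pdivlMr// /err; apply: mx_norm_le => [|i j].
      by rewrite divr_ge0// ltW.
    rewrite ord1 AE col_of_bool !mxE ler_pdivlMr// [leLHS]mulrC; case: ifP => _ //.
    by rewrite addr0 normr0 mulr0.
exists A; split.
- have [t0 tU] := U; exists t0 => t /tU; apply: up; exact: ltW.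
- exists c => // t0; have [t tt0 tL] := L t0; exists t => // b b' b0 bt.
  pose y (a : bool) := b (inord a) 0.
  have y0 : exists a, y a != 0.
    have [i [j]] := intmx_neq0 b0; rewrite ord1; exists (odd i).
    rewrite /y (_ : inord _ = i)//; apply: val_inj; rewrite /= inordK.
      by case: i {p} => [[|[|]]].
    by case: (odd i).
  have yt a : `|y a|%:~R <= t.
    by apply: le_trans bt; have := mx_norm_coord (intmx b) (inord a) 0;
      rewrite !mxE intr_norm.
  pose i (a : bool) : 'I_m := Ordinal (leq_ltn_trans (leq_b1 a) m1).
  have [a /le_trans] := tL y (fun a => b' (i a) 0) y0 yt; apply.
  apply: ler_wpM2l; first exact: powR_ge0.
  have := mx_norm_coord (A *m intmx b + intmx b') (i a) 0; rewrite AE /=.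
  by rewrite (leq_ltn_trans (leq_b1 a)) // /y; case: a.
- move=> h t0 h0; have [t tt0 tZ] := Z h t0 h0; exists t => //; apply: up => //.
  exact: ltW.
Qed.

Lemma singular_block_row (e : R) : 0 < e ->
  exists A : 'M[R]_(1, 2), singular_block A 2 e.
Proof.
move=> e0; have [x [U [c c0 L] Z]] := singular_linear_form e0.
pose A : 'M[R]_(1, 2) := \matrix_(i, j) x (odd j).
have errE b b' : err A b b' = `|(b (inord false) 0)%:~R * x false
    + (b (inord true) 0)%:~R * x true + (b' 0 0)%:~R|.
  have AE : (A *m intmx b + intmx b') 0 0 = (b (inord false) 0)%:~R * x false
    + (b (inord true) 0)%:~R * x true + (b' 0 0)%:~R.
    rewrite !mxE big_ord_recl big_ord1 !mxE /=; congr (_ + _ + _); rewrite mulrC;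
      by congr (_%:~R * _); congr (b _ _); apply: val_inj; rewrite /= inordK.
  apply/eqP; rewrite eq_le -AE mx_norm_coord andbT; apply: mx_norm_le => // i j.
  by rewrite !ord1.
have sq t : 0 <= t -> t `^ 2 = t ^+ 2 by move=> t0; rewrite powR_mulrn.
have up t h : 0 <= h -> (exists (y : bool -> int) (p : int),
        [/\ exists b, y b != 0, forall b, `|y b|%:~R <= t &
          t ^+ 2 * `|(y false)%:~R * x false + (y true)%:~R * x true + p%:~R| <= h]) ->
    small_at A 2 h t.
  move=> h0 [y [p [[b0 yb0] yt yp]]].
  have t0 : 0 <= t by exact: le_trans (yt true).
  exists (\col_(j < 2) y (odd j)), (const_mx p); split.
  - apply: contra_neq yb0 => /matrixP/(_ (inord b0) 0).
    by rewrite col_of_bool mxE.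
  - by apply: mx_norm_le => [//|i j]; rewrite !mxE -intr_norm.
  - by rewrite sq// errE !col_of_bool mxE.
exists A; split.
- have [t0 tU] := U; exists t0 => t /tU; apply: up; exact: ltW.
- exists c => // t0; have [t tt0 tL] := L t0; exists t => // b b' b0 bt.
  rewrite sq ?(le_trans _ bt)// errE; apply: (tL (fun a : bool => b (inord a) 0)).
    have [i [j]] := intmx_neq0 b0; rewrite ord1; exists (odd i).
    rewrite (_ : inord _ = i)//; apply: val_inj; rewrite /= inordK.
      by case: i {p} => [[|[|]]].
    by case: (odd i).
  move=> a; apply: le_trans bt; have := mx_norm_coord (intmx b) (inord a) 0.
  by rewrite !mxE intr_norm.
- move=> h t0 h0; have [t tt0 tZ] := Z h t0 h0; exists t => //; apply: up => //.
  exact: ltW.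
Qed.

(** For [n < m] the block is a column, and [m / n <= 2] supplies [1 / 2 <= w]; otherwise it has two
    columns. For [m = 1], the lower bound on the ratio and the exclusion of [m = n = 1] leave
    [n = 2], where [l = 0] and the required dimension is negative. *)
Lemma singular_block_exists m n (e : R) : (0 < m)%N -> (0 < n)%N ->
    1 / 2 <= m%:R / n%:R :> R -> m%:R / n%:R <= 2 :> R ->
    ~ (m = 1%N /\ n = 1%N) -> 0 < e ->
  exists k l (A : 'M[R]_(m, k)), [/\ n = (k + l)%N,
    m%:R * n%:R - 2 * Num.max m%:R n%:R <= (m * l)%:R :> R &
    singular_block A (n%:R / m%:R) e].
Proof.
move=> m0 n0 lo hi mn e0.
have mR0 : 0 < m%:R :> R by rewrite ltr0n.
have nR0 : 0 < n%:R :> R by rewrite ltr0n.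
have [nm|mn'] := ltnP n m.
  have wlt : n%:R / m%:R < 1 :> R by rewrite ltr_pdivrMr// mul1r ltr_nat.
  have wge : 1 / 2 <= n%:R / m%:R :> R.
    by move: hi; rewrite ler_pdivrMr// => h; rewrite ler_pdivlMr//; lra.
  have [A AP] := singular_block_column (leq_ltn_trans n0 nm) wge wlt e0.
  exists 1%N, n.-1, A; split=> //; first by rewrite add1n prednK.
  have nE : n%:R = n.-1%:R + 1 :> R by rewrite natr1 prednK.
  rewrite (max_l (ltW _)) ?ltr_nat// nE natrM; nra.
have wge : 1 <= n%:R / m%:R :> R by rewrite ler_pdivlMr// mul1r ler_nat.
have n1 : (1 < n)%N.
  by rewrite ltn_neqAle n0 andbT eq_sym; apply/eqP => n1; apply: mn; lia.
have nE : n%:R = n.-2%:R + 2 :> R by rewrite -natrD; congr _%:R; lia.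
have dim : m%:R * n%:R - 2 * Num.max m%:R n%:R <= (m * n.-2)%:R :> R.
  rewrite max_r ?ler_nat// natrM.
  have : m%:R <= n%:R :> R by rewrite ler_nat.
  rewrite nE; nra.
have [m1|m1] := ltnP 1 m.
  have [A AP] := singular_block_diagonal m1 wge e0.
  by exists 2%N, n.-2, A; split=> //; lia.
have {m0 m1}m1 : m = 1%N by lia.
subst m.
have n2 : n = 2%N.
  have : n%:R <= 2 :> R by move: lo; rewrite mul1r ler_pdivlMr//; lra.
  rewrite (ler_nat R n 2); lia.
subst n; have [A AP] := singular_block_row e0.
by exists 2%N, 0%N, A; split=> //; rewrite divr1.
Qed.

End SingularBlock.

(** * Random matrices *)

Lemma measure_finite_union_le d (T : measurableType d) (R : realType)
    (mu : {measure set T -> \bar R}) (I : finType) (A : set T) (F : I -> set T)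
    (c : \bar R) :
    measurable A -> (forall i, measurable (F i)) -> (forall i, mu (F i) <= c)%E ->
    A `<=` [set x | exists i, F i x] ->
  (mu A <= c *+ #|I|)%E.
Proof.
move=> mA mF Fc AF.
pose G k := if insub k is Some i then F (enum_val (i : 'I_#|I|)) else set0.
have mG k : measurable (G k) by rewrite /G; case: insubP.
have := @content_subadditive _ _ _ mu A G #|I| (fun k _ => mG k) mA.
move=> /(_ _)/le_trans; apply.
  move=> x /AF[i Fix]; rewrite -bigcup_mkord; exists (enum_rank i) => //=.
  by rewrite /G valK enum_rankK.
apply: (@le_trans _ _ (\sum_(k < #|I|) c)%E).
  by apply: lee_sum => k _; rewrite /G valK; exact: Fc.
by rewrite sumr_const card_ord.
Qed.

Section Uniform.
Variable R : realType.

Local Notation U := (uniform_prob (@ltr01 R)).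

Lemma uniform_le (A : set R) : measurable A -> (U A <= lebesgue_measure A)%E.
Proof.
move=> mA; rewrite /uniform_prob.
apply: (@le_trans _ _ (\int[lebesgue_measure]_(x in A) (cst 1) x)%E).
  apply: ge0_le_integral => //.
  - by move=> x _; rewrite lee_fin uniform_pdf_ge0 ?ltr01.
  - by apply/measurable_EFinP/measurable_funTS; exact: measurable_uniform_pdf.
  - move=> x _; rewrite lee_fin /uniform_pdf subr0 invr1; case: ifP => //.
by rewrite integral_cst// mul1e.
Qed.

Lemma uniform_setI01 (A : set R) : U A = U (A `&` `[0, 1]).
Proof. by rewrite /uniform_prob integral_uniform_pdf. Qed.

Definition near_int (e : R) : set R := [set y | exists z : int, `|y + z%:~R| < e].

Lemma open_near_int e : open (near_int e).
Proof.
rewrite (_ : near_int e = \bigcup_(z in [set: int]) ball (- z%:~R : R) e).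
  by apply: bigcup_open => z _; exact: ball_open.
rewrite eqEsubset; split => y.
  by move=> [z yz]; exists z => //; rewrite /ball /= distrC opprK.
by move=> [z _]; rewrite /ball /= distrC opprK => yz; exists z.
Qed.

Lemma measurable_near_int e : measurable (near_int e).
Proof. apply: open_measurable; exact: open_near_int. Qed.

(** On the unit interval [a + x * b] sweeps a length [|b|], so it comes within [e] of at most
    [|b| + 2] integers, each for [x] in an interval of length [2 * e / |b|]; as [1 <= |b|], the sum
    is at most [6 * e]. *)
Lemma uniform_near_int (a e : R) (b : int) : b != 0 -> 0 < e -> e <= 1 / 2 ->
  (U [set x | near_int e (a + x * b%:~R)%R] <= (6 * e)%R%:E)%E.
Proof.
move=> b0 e0 e12.
set S := (X in U X).
have mS : measurable S.
  rewrite -[S]setTI; apply: (_ : measurable_fun setT (fun x : R => a + x * b%:~R)).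
  - apply: measurable_funD => //; exact: measurable_funM.
  - by [].
  - exact: measurable_near_int.
pose q := `|b|%N.
have q0 : (0 < q)%N by rewrite absz_gt0.
have qR0 : 0 < q%:R :> R by rewrite ltr0n.
have qE : q%:R = `|b%:~R| :> R by rewrite -intr_norm -abszE pmulrn.
(* A lower bound for the integers involved, from [x * b <= max 0 b] and [e <= 1 / 2]; they are
   counted from there. *)
pose z0 := Num.floor (- a - Num.max 0 b%:~R - 1 / 2).
pose F (i : 'I_(q + 2)) : set R := ball ((- a - (z0 + i%:Z)%:~R) / b%:~R) (e / q%:R).
rewrite uniform_setI01.
have bR0 : b%:~R != 0 :> R by rewrite intr_eq0.
have mS' : measurable (S `&` `[0, 1]) by exact: measurableI.
have Fle i : (lebesgue_measure (F i) <= (2 * e / q%:R)%:E)%E.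
  rewrite lebesgue_measure_ball; last by apply: divr_ge0 => //; exact: ltW.
  by rewrite lee_fin mulr2n -mulrA; lra.
have mF i : measurable (F i) by exact: measurable_ball.
have SF : S `&` `[0, 1] `<=` [set x | exists i, F i x].
  move=> x [[z xz] /=]; rewrite in_itv /= => /andP[x0 x1].
  have zlo : - a - Num.max 0 b%:~R - 1 / 2 < z%:~R.
    have : x * b%:~R <= Num.max 0 b%:~R.
      have [b1|b1] := leP 0 (b%:~R : R); nra.
    move: xz; rewrite ltr_norml => /andP[]; lra.
  have zhi : z%:~R < - a - Num.max 0 b%:~R - 1 / 2 + q%:R + 1.
    have : Num.max 0 b%:~R - q%:R <= x * b%:~R.
      rewrite qE; have [b1|b1] := leP 0 (b%:~R : R).
        rewrite ger0_norm//; nra.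
      rewrite ltr0_norm//; nra.
    move: xz; rewrite ltr_norml => /andP[]; lra.
  have z0z : z0 <= z.
    by rewrite -(ler_int R); apply: le_trans (ltW zlo); exact: ge_floor.
  have zz0 : (z - z0 < q%:Z + 2).
    rewrite -(ltr_int R) rmorphB rmorphD /= -pmulrn.
    have := lt_succ_floor (- a - Num.max 0 b%:~R - 1 / 2).
    rewrite -/z0 rmorphD /=; lra.
  have iq : (`|z - z0|%N < q + 2)%N by lia.
  exists (Ordinal iq); rewrite /F /ball /= -[_ / q%:R]mulr1.
  have -> : z0 + `|z - z0|%N%:Z = z by lia.
  rewrite mulr1 distrC ltr_pdivlMr// qE -normrM.
  rewrite (_ : _ * b%:~R = a + x * b%:~R + z%:~R)//.
  by field.
apply: le_trans (uniform_le mS') _.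
apply: le_trans (measure_finite_union_le (mu := lebesgue_measure) mS' mF Fle SF) _.
rewrite card_ord -EFin_natmul lee_fin -[leLHS]mulr_natl mulrA ler_pdivrMr//.
have : 1 <= q%:R :> R by rewrite ler1n.
rewrite natrD; nra.
Qed.

Lemma product_probability_xsection_le d1 d2 (T1 : measurableType d1)
    (T2 : measurableType d2) (P1 : probability T1 R) (P2 : probability T2 R)
    (S : set (T1 * T2)) (c : \bar R) :
    measurable S -> (0 <= c)%E -> (forall x, P2 (xsection S x) <= c)%E ->
  ((P1 \x P2) S <= c)%E.
Proof.
move=> mS c0 Sc; rewrite /product_measure1.
apply: (@le_trans _ _ (\int[P1]_x (cst c) x)%E).
  apply: ge0_le_integral => //.
  - exact: measurable_fun_xsection.
  - by move=> x _; exact: Sc.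
rewrite integral_cst// (_ : (c * _)%E = c)//.
by rewrite -[RHS]mule1; congr (_ * _)%E; exact: (probability_setT P1).
Qed.

Lemma product_probability_ysection_le d1 d2 (T1 : measurableType d1)
    (T2 : measurableType d2) (P1 : probability T1 R) (P2 : probability T2 R)
    (S : set (T1 * T2)) (c : \bar R) :
    measurable S -> (0 <= c)%E -> (forall y, P1 (ysection S y) <= c)%E ->
  ((P1 \x P2) S <= c)%E.
Proof.
move=> mS c0 Sc.
rewrite (@product_measure_unique _ _ _ _ _ P1 P2 (P1 \x^ P2)%E)//; last first.
  by move=> A B mA mB; rewrite /= product_measure2E.
rewrite /= /product_measure2.
apply: (@le_trans _ _ (\int[P2]_x (cst c) x)%E).
  apply: ge0_le_integral => //.
  - exact: measurable_fun_ysection.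
  - by move=> x _; exact: Sc.
rewrite integral_cst// (_ : (c * _)%E = c)//.
by rewrite -[RHS]mule1; congr (_ * _)%E; exact: (probability_setT P2).
Qed.

(* The last clause bounds the probability of an event by a uniform bound over
   its one-dimensional sections in the direction of a single coordinate. *)
Lemma product_probability_iid d (T : measurableType d) (P : probability T R)
    (m : nat) :
  exists d' (T' : measurableType d') (P' : probability T' R) (Y : 'I_m -> T' -> T),
    [/\ forall i, measurable_fun setT (Y i),
      forall A : 'I_m -> set T, (forall i, measurable (A i)) ->
        P' [set x | forall i, A i (Y i x)] = (\prod_i fine (P (A i)))%:E
    & forall i (S : set ('I_m -> T)) c, (0 <= c)%E ->
        measurable [set x | S (Y^~ x)] ->
        (forall y, P [set t | S (fun j => if j == i then t else y j)] <= c)%E ->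
        (P' [set x | S (Y^~ x)] <= c)%E].
Proof.
elim: m => [|m [d' [T' [P' [Y [mY PY SY]]]]]].
  exists d, T, P, (fun _ x => x); split=> [[]//|A mA|[]//].
  rewrite big_ord0 -(probability_setT P); congr (P _).
  by apply/seteqP; split=> // x _ [].
pose cons (t : T) (y : 'I_m -> T) (i : 'I_m.+1) :=
  if unlift ord0 i is Some j then y j else t.
exists _, (T * T')%type, [the probability _ _ of (P \x P')%E].
exists (fun i z => cons z.1 (Y^~ z.2) i); split.
- move=> i; rewrite /cons; case: unlift => [j|]; last exact: measurable_fst.
  exact: measurableT_comp (mY j) measurable_snd.
- move=> A mA.
  have mB : measurable [set x | forall i : 'I_m, A (lift ord0 i) (Y i x)].
    rewrite (_ : mkset _ = \bigcap_(i in setT) (Y i @^-1` A (lift ord0 i))).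
      apply: fin_bigcap_measurable => // i _.
      by rewrite -[X in measurable X]setTI; exact: mY.
    by apply/seteqP; split=> [x h i _|x h i]; exact: h.
  rewrite (_ : mkset _ = A ord0 `*` [set x | forall i : 'I_m, A (lift ord0 i) (Y i x)]).
    have /= PYA := PY (fun i => A (lift ord0 i)) (fun i => mA _).
    apply: (etrans (product_measure1E P P' (mA ord0) mB)).
    rewrite big_ord_recl EFinM; congr (_ * _)%E; last exact: PYA.
    by rewrite fineK ?fin_num_measure.
  rewrite /cons; apply/seteqP; split=> [[x y] h|[x y] [h0 h] i] /=.
    split; first by have := h ord0; rewrite unlift_none.
    by move=> i; have := h (lift ord0 i); rewrite liftK.
  by case: unliftP => [j ->|->]; [exact: h|exact: h0].
- move=> i S c c0 mS Sc.
  (* A later coordinate is treated by induction in the sections at a fixed first coordinate; the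
     first coordinate itself is the variable of the sections in the other direction. *)
  have [j ij|i0] := unliftP ord0 i.
    apply: product_probability_xsection_le => // t.
    rewrite (_ : xsection _ t = [set x | S (cons t (Y^~ x))]); last first.
      by apply/seteqP; split=> x; rewrite /xsection /= inE.
    apply: (SY j (fun y => S (cons t y)) c c0).
      have := measurable_xsection t mS; congr measurable.
      by apply/seteqP; split=> x; rewrite /xsection /= inE.
    move=> y; have := Sc (cons t y); congr (P _ <= _)%E.
    apply: eq_set => x; congr S; apply/funext => k; rewrite /cons ij.
    case: unliftP => [k' ->|->]; first by rewrite (inj_eq lift_inj).
    by rewrite (negbTE (neq_lift _ _)).
  apply: product_probability_ysection_le => // z.
  have := Sc (cons point (Y^~ z)); congr (P _ <= _)%E.
  rewrite /ysection; apply: eq_set => t /=.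
  rewrite inE /=; congr S; apply/funext => k; rewrite /cons i0.
  by case: unliftP => [k' ->|->]; rewrite ?eqxx// eq_sym (negbTE (neq_lift _ _)).
Qed.

Lemma uniform_interval_le (a r : R) : 0 <= r ->
  (U [set x | `|x - a| <= r]%R <= (2 * r)%:E)%E.
Proof.
move=> r0; rewrite (_ : mkset _ = `[a - r, a + r]%classic); last first.
  by apply: eq_set => x; rewrite in_itv /= ler_distl.
apply: le_trans (uniform_le _) _; first exact: measurable_itv.
rewrite lebesgue_measure_itv /=; case: ifP => _; last by rewrite lee_fin mulr_ge0.
by rewrite -EFinB lee_fin; lra.
Qed.

Lemma uniform_01 : U [set x | 0 <= x <= 1]%R = 1%E.
Proof.
rewrite (_ : mkset _ = `[0, 1]%classic); last by apply: eq_set => x; rewrite in_itv.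
by rewrite /uniform_prob integral_uniform_pdf1// ltr01.
Qed.

(** Independent uniform entries, drawn as [m] independent copies of a row of [l] independent
    entries, so that the event of the last clause is a product over the rows. Within a row, all
    entries are frozen except one that meets a nonzero entry of [b]. *)
Lemma uniform_matrix (m l : nat) :
  exists d (T : measurableType d) (P : probability T R) (X : T -> 'M[R]_(m, l)),
  [/\ measurable [set x | forall i j, 0 <= X x i j <= 1] /\
      P [set x | forall i j, 0 <= X x i j <= 1]%R = 1%E,
    forall (u : 'M[R]_(m, l)) r, 0 <= r ->
      measurable [set x | forall i j, `|X x i j - u i j| <= r] /\
      (P [set x | forall i j, `|X x i j - u i j| <= r]%R
        <= ((2 * r) ^+ (m * l))%:E)%E
  & forall (b : 'cV[int]_l) (a : 'cV[R]_m) e, b != 0 -> 0 < e -> e <= 1 / 2 ->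
      let S := [set x | forall i, near_int e ((a + X x *m map_mx intr b) i 0)] in
      measurable S /\ (P S <= ((6 * e) ^+ m)%:E)%E].
Proof.
have [d1 [T1 [P1 [Y [mY PY SY]]]]] := product_probability_iid U l.
have [d2 [T2 [P2 [Z [mZ PZ _]]]]] := product_probability_iid P1 m.
pose X x : 'M[R]_(m, l) := \matrix_(i, j) Y j (Z i x).
have mrow (A : 'I_l -> set R) : (forall j, measurable (A j)) ->
    measurable [set y | forall j, A j (Y j y)].
  move=> mA; rewrite (_ : mkset _ = \bigcap_(j in setT) (Y j @^-1` A j)).
    apply: fin_bigcap_measurable => // i _.
    by rewrite -[X in measurable X]setTI; exact: (mY i measurableT _ (mA i)).
  by apply/seteqP; split=> [x h i _|x h i]; exact: h.
have mmx (A : 'I_m -> set T1) : (forall j, measurable (A j)) ->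
    measurable [set y | forall j, A j (Z j y)].
  move=> mA; rewrite (_ : mkset _ = \bigcap_(j in setT) (Z j @^-1` A j)).
    apply: fin_bigcap_measurable => // i _.
    by rewrite -[X in measurable X]setTI; exact: mZ.
  by apply/seteqP; split=> [x h i _|x h i]; exact: h.
have box (A : 'I_m -> 'I_l -> set R) : (forall i j, measurable (A i j)) ->
    measurable [set x | forall i j, A i j (X x i j)] /\
    P2 [set x | forall i j, A i j (X x i j)] =
      (\prod_i \prod_j fine (U (A i j)))%:E.
  move=> mA; rewrite (_ : mkset _ =
      [set x | forall i, [set y | forall j, A i j (Y j y)] (Z i x)]); last first.
    by apply/seteqP; split=> x h i j; have := h i j; rewrite mxE.
  have mArow i := mrow _ (mA i).
  split; first exact: mmx mArow.
  rewrite (PZ _ mArow).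
  by congr EFin; apply: eq_bigr => i _; rewrite (PY _ (mA i)).
exists d2, T2, P2, X; split.
- have m01 : measurable [set x : R | 0 <= x <= 1].
    rewrite (_ : mkset _ = `[0, 1]%classic); last by apply: eq_set => x; rewrite in_itv.
    exact: measurable_itv.
  have [mb ->] := box (fun _ _ => [set x | 0 <= x <= 1]) (fun _ _ => m01); split=> //.
  by rewrite uniform_01 /= big1// => i _; rewrite big1.
- move=> u r r0.
  have mI (a : R) : measurable [set x | `|x - a| <= r].
    rewrite (_ : mkset _ = `[a - r, a + r]%classic); last first.
      by apply: eq_set => x; rewrite in_itv /= ler_distl.
    exact: measurable_itv.
  have [mb ->] := box (fun i j => [set x | `|x - u i j| <= r]) (fun i j => mI _).
  split=> //; rewrite lee_fin.
  apply: (@le_trans _ _ (\prod_(i < m) \prod_(j < l) (2 * r))); last first.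
    by rewrite !prodr_const !card_ord -exprM mulnC.
  apply: ler_prod => i _; apply/andP; split.
    by apply: prodr_ge0 => j _; rewrite fine_ge0.
  apply: ler_prod => j _; rewrite fine_ge0//=.
  by rewrite -lee_fin fineK; [exact: uniform_interval_le|
    rewrite fin_num_measure//; exact: mI].
- move=> b a e b0 e0 e12 S.
  pose A i : set T1 := [set y | near_int e (a i 0 + \sum_j Y j y * (b j 0)%:~R)].
  have mA i : measurable (A i).
    rewrite -[A i]setTI.
    apply: (_ : measurable_fun setT (fun y => a i 0 + \sum_j Y j y * (b j 0)%:~R)) => //.
      apply: measurable_funD => //; apply: measurable_sum => j.
      by apply: measurable_funM => //; exact: mY.
    exact: measurable_near_int.
  have SE : S = [set x | forall i, A i (Z i x)].
    apply: eq_set => x; apply: eq_forall => i; congr near_int.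
    by rewrite !mxE; congr (_ + _); apply: eq_bigr => j _; rewrite !mxE.
  rewrite SE; split; first exact: mmx.
  rewrite PZ// lee_fin.
  apply: (@le_trans _ _ (\prod_(i < m) (6 * e))); last by rewrite prodr_const card_ord.
  apply: ler_prod => i _; rewrite fine_ge0//=.
  rewrite -lee_fin fineK ?fin_num_measure//.
  have [k bk] : exists k, b k 0 != 0.
    apply: contrapT => /forallNP nb; move: b0; apply/negP; rewrite negbK.
    by apply/eqP/matrixP => k k'; rewrite ord1 mxE; apply/eqP/negPn/negP/nb.
  apply: (SY k (fun y => near_int e (a i 0 + \sum_j y j * (b j 0)%:~R))).
  + by rewrite lee_fin mulr_ge0// ltW.
  + exact: mA.
  + move=> y; have := uniform_near_int (a i 0 +
        \sum_(j | j != k) y j * (b j 0)%:~R) bk e0 e12.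
    congr (U _ <= _)%E; apply: eq_set => t; congr near_int.
    rewrite [in RHS](bigD1 k)//= eqxx -addrA [t * _ + _]addrC; congr (_ + (_ + _)).
    by apply: eq_bigr => j /negbTE->.
Qed.

End Uniform.

(** * Hausdorff dimension *)

(** The mass carried to [E] is that of [P] on [A]; the measurable sets [M] stand in for preimages of
    balls, [F] being an arbitrary function. A set of diameter [r <= 1] lies in a ball of radius [r]
    around any of its points, so for [s < D] its mass is at most [c * r ^ D <= c * r ^ s]. *)
Lemma mass_distribution (R : realType) (V : normedModType R) d
    (T : measurableType d) (P : probability T R) (F : T -> V) (A : set T)
    (E : set V) (c : R) (D : nat) :
    measurable A -> (0 < P A)%E -> 0 <= c -> (forall x, A x -> E (F x)) ->
    (forall u r, 0 <= r -> exists M, [/\ measurable M,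
       forall x, `|F x - u| <= r -> M x & (P M <= (c * r ^+ D)%:E)%E]) ->
  ((D%:R : R)%:E <= hausdorff_dim E)%E.
Proof.
move=> mA PA0 c0 AE PM; apply: le_ereal_inf_tmp => _ [s [s0 Hs] <-].
rewrite lee_fin leNgt; apply/negP => sD.
have D0 : (0 < D)%N by rewrite -(ltr_nat R); exact: le_lt_trans sD.
pose p := fine (P A).
have pE : P A = p%:E by rewrite fineK// fin_num_measure.
have p0 : 0 < p by rewrite -lte_fin -pE.
have c1 : 0 < c + 1 by lra.
(* A cover with gauge sum below [p / (c + 1)] has mass below [p], a contradiction; [c + 1] allows
   for [c = 0]. *)
have : (hausdorff_premeasure s 1 E < (p / (c + 1))%:E)%E.
  apply: (@le_lt_trans _ _ 0%E); last by rewrite lte_fin divr_gt0.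
  by rewrite -Hs; apply: ereal_sup_ubound; exists 1 => //=.
move=> /ereal_inf_lt[_ [U [EU U1] <-] Usum].
have cover i : exists M, [/\ measurable M, forall x, U i (F x) -> M x &
    (P M <= c%:E * hausdorff_gauge s (U i))%E].
  have [U0|/set0P[u Uu]] := eqVneq (U i) set0.
    exists set0; split=> //; first by rewrite U0.
    by rewrite measure0 /hausdorff_gauge U0 eqxx mule0.
  have dist x : U i x -> (`|x - u|%:E <= diameter (U i))%E.
    by move=> Ux; apply: ereal_sup_ubound; exists x => //; exists u.
  have d0 : (0 <= diameter (U i))%E by have := dist u Uu; rewrite subrr normr0.
  pose r := fine (diameter (U i)).
  have rE : diameter (U i) = r%:E.
    by rewrite fineK// ge0_fin_numE//; apply: le_lt_trans (U1 i) _; rewrite ltry.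
  have r0 : 0 <= r by rewrite -lee_fin -rE.
  have r1 : r <= 1 by rewrite -lee_fin -rE.
  have [M [mM MF PMr]] := PM u r r0; exists M; split=> //.
    by move=> x /dist; rewrite rE lee_fin; exact: MF.
  apply: le_trans PMr _.
  rewrite /hausdorff_gauge ifF; last by apply/negbTE/set0P; exists u.
  rewrite rE poweR_EFin -EFinM lee_fin ler_wpM2l//.
  (* Diameter 0 is separate: there [r ^ D] vanishes because [0 < D]. *)
  rewrite le_eqVlt in r0; case/orP: r0 => [/eqP<-|r0].
    by rewrite expr0n -[D == 0%N]negbK -lt0n D0 powR_ge0.
  by rewrite -powR_mulrn ?(ltW r0)//; apply: ger_powR; rewrite ?r0// ltW.
have /choice[M MP] := cover.
have gauge0 i : (0 <= hausdorff_gauge s (U i))%E.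
  by rewrite /hausdorff_gauge; case: ifP => // _; exact: poweR_ge0.
have : (P A <= \sum_(0 <= i <oo) P (M i))%E.
  apply: measure_sigma_subadditive => //; first by move=> i; case: (MP i).
  by move=> x /AE/EU[i _ Ui]; exists i => //; have [_ + _] := MP i; exact.
apply/negP; rewrite -ltNge.
apply: (@le_lt_trans _ _ (\sum_(0 <= i <oo) c%:E * hausdorff_gauge s (U i))%E).
  by apply: lee_nneseries => i _ //; case: (MP i).
rewrite nneseriesZl//.
apply: (@le_lt_trans _ _ (c%:E * (p / (c + 1))%:E)%E).
  by apply: lee_wpmul2l; rewrite ?lee_fin// ltW.
rewrite pE -EFinM lte_fin mulrA ltr_pdivrMr//; lra.
Qed.

Lemma hausdorff_premeasure_mono (R : realType) (V : normedModType R) (s r : R)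
    (E F : set V) : E `<=` F ->
  (hausdorff_premeasure s r E <= hausdorff_premeasure s r F)%E.
Proof.
move=> EF; apply: ereal_inf_le_tmp => _ [U [FU U1] <-]; exists U => //; split=> //.
exact: subset_trans FU.
Qed.

Lemma hausdorff_gauge_ge0 (R : realType) (V : normedModType R) (s : R) (E : set V) :
  (0 <= hausdorff_gauge s E)%E.
Proof. by rewrite /hausdorff_gauge; case: ifP => // _; exact: poweR_ge0. Qed.

Lemma hausdorff_measure_ge0 (R : realType) (V : normedModType R) (s : R) (E : set V) :
  (0 <= hausdorff_measure s E)%E.
Proof.
apply: le_trans (ereal_sup_ubound _) => /=; last by exists 1.
apply: le_ereal_inf_tmp => _ [U _ <-]; apply: nneseries_ge0 => i _ _.
exact: hausdorff_gauge_ge0.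
Qed.

Lemma hausdorff_dim_mono (R : realType) (V : normedModType R) (E F : set V) :
  E `<=` F -> (hausdorff_dim E <= hausdorff_dim F)%E.
Proof.
move=> EF; apply: ereal_inf_le_tmp => _ [s [s0 Fs] <-]; exists s => //; split=> //.
apply/eqP; rewrite eq_le hausdorff_measure_ge0 andbT -Fs.
apply: ge_ereal_sup => _ [r r0 <-].
apply: le_trans (hausdorff_premeasure_mono s r EF) _.
by apply: ereal_sup_ubound; exists r.
Qed.

(** * Norms and the Dirichlet function *)

Section Norms.
Variables (R : realType) (k : nat) (N : 'cV[R]_k -> R).
Hypothesis normN : is_norm N.

Lemma norm_eq0 : N 0 = 0.
Proof. by have [_ NZ _] := normN; rewrite -(scale0r 0) NZ normr0 mul0r. Qed.

Lemma norm_opp x : N (- x) = N x.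
Proof. by have [_ NZ _] := normN; rewrite -scaleN1r NZ normrN1 mul1r. Qed.

Lemma norm_ge0 x : 0 <= N x.
Proof.
have [ND _ _] := normN.
by have := ND x (- x); rewrite subrr norm_eq0 norm_opp; lra.
Qed.

Lemma norm_sum (I : Type) (s : seq I) (F : I -> 'cV[R]_k) :
  N (\sum_(i <- s) F i) <= \sum_(i <- s) N (F i).
Proof.
have [ND _ _] := normN; elim: s => [|a s IHs]; first by rewrite !big_nil norm_eq0.
by rewrite !big_cons; apply: le_trans (ND _ _) _; rewrite lerD2l.
Qed.

Lemma norm_le_max_norm : exists2 C, 0 < C & forall x, N x <= C * `|x|.
Proof.
have [_ NZ _] := normN.
exists (1 + \sum_i N (delta_mx i 0)).
  by apply: ltr_pwDl => //; apply: sumr_ge0 => i _; exact: norm_ge0.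
move=> x; rewrite mulrDl mul1r mulr_suml -[leLHS]add0r lerD//.
have xE : x = \sum_i x i 0 *: delta_mx i 0.
  by rewrite [LHS]matrix_sum_delta; apply: eq_bigr => i _; rewrite big_ord1.
rewrite [in leLHS]xE; apply: le_trans (norm_sum _ _) _; apply: ler_sum => i _.
by rewrite NZ mulrC; apply: ler_wpM2l; [exact: norm_ge0|exact: mx_norm_coord].
Qed.

(** [N] is continuous by the bound from above, so it attains a positive minimum on the compact unit
    sphere of the maximum norm, nonempty since [0 < k]. The sphere is transposed to row vectors, the
    setting of the extreme value theorem used. *)
Lemma max_norm_le_norm : (0 < k)%N -> exists2 c, 0 < c & forall x, c * `|x| <= N x.
Proof.
move=> k0; have [ND NZ N0] := normN.
have trN (v : 'rV[R]_k) : `|v^T| = `|v|.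
  apply/eqP; rewrite eq_le; apply/andP; split; apply: mx_norm_le => // i j.
    by rewrite mxE; exact: mx_norm_coord.
  by have := mx_norm_coord v^T j i; rewrite mxE.
have [C C0 NC] := norm_le_max_norm.
pose S : set 'rV[R]_k := [set v | `|v| = 1].
have S0 : S !=set0.
  exists (const_mx 1); apply/eqP; rewrite eq_le; apply/andP; split.
    by apply: mx_norm_le => // i j; rewrite mxE normr1.
  by have := mx_norm_coord (const_mx 1 : 'rV[R]_k) 0 (Ordinal k0); rewrite mxE normr1.
have cS : compact S.
  apply: bounded_closed_compact.
    exists 1; split=> [|M M1 v /= ->]; [exact: real1|exact: ltW].
  have -> : S = Num.norm @^-1` [set x : R | x = 1] by [].
  apply: closed_comp; last exact: closed_eq.
  by move=> v _; exact: norm_continuous.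
have cN : continuous (fun v : 'rV[R]_k => N v^T).
  move=> v; apply/(@cvgrPdist_le _ _ _ (nbhs v) (nbhs_filter v)) => e e0; near=> u.
  have NB x y : `|N x - N y| <= N (x - y).
    rewrite ler_norml; apply/andP; split.
      by have := ND (y - x) x; rewrite subrK -(norm_opp (y - x)) opprB; lra.
    by have := ND (x - y) y; rewrite subrK; lra.
  apply: le_trans (NB _ _) _; rewrite -linearB.
  apply: le_trans (NC _) _; rewrite trN mulrC -ler_pdivlMr//.
  near: u; apply/nbhs_ballP; exists (e / C) => /=; first exact: divr_gt0.
  by move=> u; rewrite mx_norm_ball => /ltW.
have [v] := EVT_min_rV S0 cS (continuous_subspaceT cN).
rewrite inE => Sv vmin; exists (N v^T).
  rewrite lt_neqAle norm_ge0 andbT eq_sym; apply/eqP => /N0 v0.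
  by move: Sv; rewrite /S /= -trN v0 normr0; apply/eqP; rewrite eq_sym oner_neq0.
move=> x; have [->|x0] := eqVneq x 0; first by rewrite normr0 mulr0 norm_eq0.
have nx : 0 < `|x| by rewrite normr_gt0.
rewrite -ler_pdivlMr//.
have /vmin : (`|x|^-1 *: x^T) \in S.
  rewrite inE /S /= normrZ -[`|x^T|]trN trmxK ger0_norm ?invr_ge0 ?ltW//.
  by rewrite mulVf// gt_eqF.
by rewrite linearZ /= trmxK NZ ger0_norm ?invr_ge0 ?(ltW nx)// mulrC.
Unshelve. all: by end_near.
Qed.

End Norms.

Section Theta.
Variables (R : realType) (m n : nat).
Variables (N1 : 'cV[R]_n -> R) (N2 : 'cV[R]_m -> R).
Hypotheses (normN1 : is_norm N1) (normN2 : is_norm N2).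
Hypotheses (m_gt0 : (0 < m)%N) (n_gt0 : (0 < n)%N).

Local Notation w := (n%:R / m%:R : R).

(** Substituting [K *m b + b'] for [b'] permutes the pairs over which the infimum is taken. *)
Lemma scaled_psi_shift (K : 'M[int]_(m, n)) (Omega : 'M[R]_(m, n)) :
  scaled_psi N1 N2 (Omega + intmx R K) = scaled_psi N1 N2 Omega.
Proof.
apply/funext => t; rewrite /scaled_psi; congr (_ * _)%E; rewrite /psi.
congr ereal_inf; apply/seteqP; split=> _ [[b b'] /= bt <-].
  exists (b, K *m b + b') => //=.
  by rewrite mulmxDl map_mxD map_mxM /= addrA.
exists (b, b' - K *m b) => //=.
by rewrite mulmxDl map_mxD map_mxN map_mxM /= -addrA [X in _ + X]addrC subrK.
Qed.

(** By equivalence of norms, passing from the maximum norm to [N1] and [N2] costs a dilation [K] of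
    [t] and a factor [C], both uniform in [Omega], [e] and [t]. *)
Lemma scaled_psi_le : exists K C : R, [/\ 0 < K, 0 < C & forall Omega e t,
  small_at Omega w e t -> (scaled_psi N1 N2 Omega (K * t) <= (C * e)%:E)%E].
Proof.
have [C1 C10 NC1] := norm_le_max_norm normN1.
have [C2 C20 NC2] := norm_le_max_norm normN2.
have [c1 c10 Nc1] := max_norm_le_norm normN1 n_gt0.
have [_ NZ1 _] := normN1; have [_ NZ2 _] := normN2.
(* A nonzero integer vector may have norm < 1, but its multiple by M has not. *)
pose M := (Num.bound c1^-1).+1.
have MR0 : 0 < M%:R :> R by rewrite ltr0n.
have c1M : 1 <= M%:R * c1.
  rewrite -ler_pdivrMr// div1r; apply: le_trans (ltW (archi_boundP _)) _.
    by rewrite invr_ge0 ltW.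
  by rewrite ler_nat.
exists (C1 * M%:R), ((C1 * M%:R) `^ w * (M%:R * C2)).
have K0 : 0 < C1 * M%:R by rewrite mulr_gt0.
split=> //; first by rewrite !mulr_gt0// powR_gt0.
move=> Omega e t [b [b' [b0 bt be]]].
have t0 : 0 <= t by exact: le_trans bt.
have bM : intmx R (b *+ M) = M%:R *: intmx R b.
  by rewrite /intmx raddfMn scaler_nat.
have bM' : intmx R (b' *+ M) = M%:R *: intmx R b'.
  by rewrite /intmx raddfMn scaler_nat.
have b1 : 1 <= `|intmx R b|.
  have [i [j bij]] := intmx_neq0 b0.
  apply: le_trans (mx_norm_coord _ i j); rewrite mxE -intr_norm ler1z.
  by rewrite -gtz0_ge1 normr_gt0.
apply: (@le_trans _ _ (((C1 * M%:R * t) `^ w)%:E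
    * (M%:R * N2 (Omega *m intmx R b + intmx R b'))%:E)%E).
  apply: lee_wpmul2l; first by rewrite lee_fin powR_ge0.
  apply: ereal_inf_lbound; exists (b *+ M, b' *+ M) => /=.
    rewrite -/(intmx R _) bM NZ1 ger0_norm//; apply/andP; split.
      apply: le_trans c1M _; rewrite ler_pM2l//; apply: le_trans (Nc1 _).
      by rewrite ler_peMr// ltW.
    rewrite mulrC mulrAC ler_pM2r//; apply: le_trans (NC1 _) _.
    by rewrite ler_pM2l.
  rewrite -/(intmx R (b *+ M)) -/(intmx R (b' *+ M)) bM bM' -scalemxAr -scalerDr.
  by rewrite NZ2 ger0_norm.
rewrite -EFinM lee_fin (powRM _ (ltW K0) t0) -!mulrA; apply: ler_wpM2l.
  exact: powR_ge0.
rewrite mulrCA; apply: ler_wpM2l => //.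
apply: (@le_trans _ _ (C2 * (t `^ w * err Omega b b'))).
  by rewrite mulrCA; apply: ler_wpM2l; [exact: powR_ge0|exact: NC2].
by apply: ler_wpM2l => //; exact: ltW.
Qed.

(** Conversely, [N1 b <= c1 * t] forces the maximum norm of [b] to be at most [t], so lower bounds
    transfer with uniform constants as well. *)
Lemma scaled_psi_ge : exists K C : R, [/\ 0 < K, 0 < C & forall Omega c t, 0 < t ->
  large_at Omega w c t -> ((C * c)%:E <= scaled_psi N1 N2 Omega (K * t))%E].
Proof.
have [c1 c10 Nc1] := max_norm_le_norm normN1 n_gt0.
have [c2 c20 Nc2] := max_norm_le_norm normN2 m_gt0.
exists c1, (c1 `^ w * c2); split=> //; first by rewrite mulr_gt0// powR_gt0.
move=> Omega c t t0 large.
have pw : 0 < (c1 * t) `^ w by rewrite powR_gt0// mulr_gt0.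
rewrite -lee_pdivrMl//; apply: le_ereal_inf_tmp => _ [[b b'] /= /andP[b1 bt] <-].
rewrite -EFinM lee_fin ler_pdivrMl//.
apply: (@le_trans _ _ ((c1 `^ w * c2) * (t `^ w * err Omega b b'))).
  apply: ler_wpM2l; first by apply: mulr_ge0; [exact: powR_ge0|exact: ltW].
  apply: large.
    apply: contraTneq b1 => ->; rewrite map_mx0 norm_eq0//.
    by rewrite -ltNge ltr01.
  by rewrite -(ler_pM2l c10); apply: le_trans (Nc1 _) bt.
rewrite mulrACA -(powRM _ (ltW c10) (ltW t0)); apply: ler_wpM2l; [exact: ltW|exact: Nc2].
Qed.

Lemma Theta_le (Omega : 'M[R]_(m, n)) (t0 e : R) :
    (forall t, t0 <= t -> (scaled_psi N1 N2 Omega t <= e%:E)%E) ->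
  (Theta N1 N2 Omega <= e%:E)%E.
Proof.
move=> He; apply: ge_ereal_inf.
exists (ereal_sup (scaled_psi N1 N2 Omega @` [set t | t0 <= t])).
  exists [set t | t0 <= t] => //; exists t0; split; first exact: num_real.
  by move=> t /ltW.
by apply: ge_ereal_sup => _ [t /= tt0 <-]; exact: He.
Qed.

Lemma Theta_ge (Omega : 'M[R]_(m, n)) (c : R) :
    (forall t0, exists2 t, t0 < t & (c%:E <= scaled_psi N1 N2 Omega t)%E) ->
  (c%:E <= Theta N1 N2 Omega)%E.
Proof.
move=> Hc; apply: le_ereal_inf_tmp => _ [S [t0 [_ St0]] <-].
have [t tt0 ct] := Hc t0; apply: le_ereal_sup_tmp.
by exists (scaled_psi N1 N2 Omega t) => //; exists t => //; exact: St0.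
Qed.

Lemma Theta_inf_le0 (Omega : 'M[R]_(m, n)) :
    (forall e t0, 0 < e -> exists2 t, t0 < t & (scaled_psi N1 N2 Omega t <= e%:E)%E) ->
  (Theta_inf N1 N2 Omega <= 0)%E.
Proof.
move=> He; rewrite /Theta_inf limf_einfE; apply: ge_ereal_sup => _ [S [t0 [_ St0]] <-].
apply/lee_addgt0Pr => e e0; rewrite add0e; have [t tt0 te] := He e t0 e0.
apply: ge_ereal_inf.
by exists (scaled_psi N1 N2 Omega t) => //; exists t => //; exact: St0.
Qed.

End Theta.

(** * Full rank by diagonal dominance *)

Lemma dominant_columns_row_free (R : realType) (m n : nat) (mn : (m <= n)%N)
    (A : 'M[R]_(m, n)) (a : R) :
    (forall (i : 'I_m) (j : 'I_n), i != j :> nat -> `|A i j| <= a) ->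
    (forall (i : 'I_m) (j : 'I_n), i = j :> nat -> m%:R * a < `|A i j|) ->
    0 <= a -> row_free A.
Proof.
move=> off diag a0; rewrite -kermx_eq0; apply/eqP/row_matrixP => r; rewrite row0.
have vA : row r (kermx A) *m A = 0 by rewrite -row_mul mulmx_ker row0.
move: (row r (kermx A)) vA => v vA; apply/eqP; apply: contraPT isT => v0 _.
have [k vk] : exists k, v 0 k != 0.
  apply: contrapT => /forallNP nv; move: v0; apply/negP; rewrite negbK.
  by apply/eqP/matrixP => k k'; rewrite ord1 mxE; apply/eqP/negPn/negP/nv.
(* In a vector of the left kernel, the coordinate [i] of largest modulus cannot be balanced by the
   others in column [i], since the diagonal entry exceeds [m * a]. *)
have [i _ imax] := @arg_maxP _ _ _ k xpredT (fun i => `|v 0 i|) isT.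
have vi : 0 < `|v 0 i|.
  by apply: lt_le_trans (imax k isT); rewrite normr_gt0.
pose j := widen_ord mn i.
have /matrixP/(_ 0 j) := vA; rewrite !mxE (bigD1 i)//= => /eqP.
rewrite addr_eq0 => /eqP/(congr1 Num.norm); rewrite normrN normrM => e.
have : `|v 0 i| * `|A i j| <= `|v 0 i| * (m%:R * a).
  rewrite e; apply: le_trans (ler_norm_sum _ _ _) _.
  apply: (@le_trans _ _ (\sum_(l < m) `|v 0 i| * a)); last first.
    by rewrite sumr_const card_ord -[leLHS]mulr_natl mulrCA.
  rewrite [leRHS](bigD1 i)//= -[leLHS]add0r; apply: lerD; first exact: mulr_ge0.
  apply: ler_sum => l li; rewrite normrM; apply: ler_pM => //; first exact: imax.
  exact: off.
by rewrite ler_pM2l// leNgt diag.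
Qed.

Lemma dominant_full_rank (R : realType) (m n : nat) (A : 'M[R]_(m, n)) (a : R) :
    0 <= a ->
    (forall (i : 'I_m) (j : 'I_n), i != j :> nat -> `|A i j| <= a) ->
    (forall (i : 'I_m) (j : 'I_n), i = j :> nat -> (m + n)%:R * a < `|A i j|) ->
  full_rank A.
Proof.
move=> a0 off diag; rewrite /full_rank /=; case: (leqP m n) => mn.
  apply/eqP; apply: (@dominant_columns_row_free R m n mn A a) => // i j ij.
  apply: le_lt_trans (diag i j ij); rewrite ler_wpM2r// ler_nat; exact: leq_addr.
rewrite -mxrank_tr.
apply/eqP; apply: (@dominant_columns_row_free R n m (ltnW mn) A^T a) => // i j ij;
  rewrite mxE.
  by apply: off; rewrite eq_sym.
apply: le_lt_trans (diag j i (esym ij)); rewrite ler_wpM2r// ler_nat; exact: leq_addl.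
Qed.

(** * Generic extensions of a singular block *)

Lemma absz_shift (z : int) (N : nat) : (`|z| <= N)%N ->
  (`|(z + N%:Z)%R| < (2 * N).+1)%N /\ `|(z + N%:Z)%R|%N%:Z - N%:Z = z.
Proof. lia. Qed.

(** At most [(3 * t) ^ (k + l)] vectors [b] are concerned, and each one that involves a column of
    [X] does too well with probability at most [(6 * e) ^ m], where [e] is a constant over [t ^ w].
    As [w * m = k + l], the powers of [t] cancel, and the factor [12 * 3 ^ (k + l)] brings the sum
    down to [1 / 2]. Vectors supported on the columns of [A] are covered by [large_at A]. *)
Lemma large_at_extension (R : realType) (m k l : nat) (A : 'M[R]_(m, k)) (c t : R)
    d (T : measurableType d) (P : probability T R) (X : T -> 'M[R]_(m, l)) :
    let w := (k + l)%:R / m%:R : R in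
    (0 < m)%N -> 1 <= t -> large_at A w c t ->
    measurable [set x | forall i j, 0 <= X x i j <= 1] ->
    P [set x | forall i j, 0 <= X x i j <= 1]%R = 1%E ->
    (forall (b : 'cV[int]_l) (a : 'cV[R]_m) e, b != 0 -> 0 < e -> e <= 1 / 2 ->
      let S := [set x | forall i, near_int e ((a + X x *m map_mx intr b) i 0)] in
      measurable S /\ (P S <= ((6 * e) ^+ m)%:E)%E) ->
  exists G, [/\ measurable G, ((1 / 2)%:E <= P G)%E & forall x, G x ->
    (forall i j, 0 <= X x i j <= 1) /\
    large_at (row_mx A (X x)) w (Num.min c (12 * 3 ^+ (k + l))^-1) t].
Proof.
set kap := (12 * 3 ^+ (k + l))^-1 => w m0 t1 largeA mC PC slab.
have t0 : 0 < t by exact: lt_le_trans ltr01 t1.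
have w0 : 0 <= w by rewrite divr_ge0.
have tw1 : 1 <= t `^ w by rewrite -(powRr0 t); exact: ler_powR.
have tw0 : 0 < t `^ w by rewrite powR_gt0.
have p3 : 1 <= 3 ^+ (k + l) :> R by rewrite exprn_ege1// ler1n.
have kap0 : 0 < kap by rewrite invr_gt0 mulr_gt0//; lra.
have kap6 : 6 * kap * 3 ^+ (k + l) = 1 / 2.
  rewrite /kap; field; apply: lt0r_neq0; lra.
pose e := kap / t `^ w.
have e0 : 0 < e by rewrite divr_gt0.
have ekap : e <= kap by rewrite ler_pdivrMr// ler_peMr// ltW.
have e12 : e <= 1 / 2 by apply: le_trans ekap _; nra.
have e60 : 0 <= 6 * e by apply: mulr_ge0 => //; exact: ltW.
pose N := Num.trunc t.
have /andP[Nt tN] : N%:R <= t < N%:R + 1 by rewrite natr1; apply: truncn_itv; exact: ltW.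
(* These functions enumerate the integer vectors with entries between [- N] and [N]. The shifts [b']
   are not enumerated, since [near_int] ranges over all integers. *)
pose I := {ffun 'I_(k + l) -> 'I_(2 * N).+1}.
pose v (f : I) : 'cV[int]_(k + l) := \col_i ((f i : nat)%:Z - N%:Z).
pose F (f : I) : set T := if dsubmx (v f) == 0 then set0 else
  [set x | forall i, near_int e ((A *m intmx R (usubmx (v f))
                     + X x *m map_mx intr (dsubmx (v f))) i 0)].
have mF f : measurable (F f).
  by rewrite /F; case: eqVneq => // vf; exact: (slab _ _ _ vf e0 e12).1.
have PF f : (P (F f) <= ((6 * e) ^+ m)%:E)%E.
  rewrite /F; case: eqVneq => // vf; last exact: (slab _ _ _ vf e0 e12).2.
  by rewrite measure0 lee_fin exprn_ge0.
pose B := [set x | exists f, F f x].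
have mB : measurable B.
  rewrite (_ : B = \bigcup_(f in [set: I]) F f).
    by apply: fin_bigcup_measurable => //; exact: finite_finset.
  by apply/seteqP; split=> [x [f fx]|x [f _ fx]]; exists f.
have PB : (P B <= (1 / 2)%:E)%E.
  apply: le_trans (measure_finite_union_le mB mF PF _) _ => //.
  rewrite card_ffun !card_ord -EFin_natmul lee_fin -[leLHS]mulr_natl natrX.
  have N3 : (2 * N).+1%:R <= 3 * t by rewrite -natr1 natrM; lra.
  apply: (@le_trans _ _ ((3 * t) ^+ (k + l) * (6 * e) ^+ m)).
    apply: ler_wpM2r; first exact: exprn_ge0.
    by apply: lerXn2r => //; rewrite nnegrE; lra.
  have te : (t `^ w) ^+ m = t ^+ (k + l).
    rewrite -powR_mulrn ?powR_ge0// -powRrM divfK ?powR_mulrn// ?(ltW t0)//.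
    by rewrite pnatr_eq0 -lt0n.
  have -> : (3 * t) ^+ (k + l) * (6 * e) ^+ m = 3 ^+ (k + l) * (6 * kap) ^+ m.
    rewrite /e [6 * _]mulrA [(6 * kap / _) ^+ m]exprMn exprVn te exprMn.
    have : t ^+ (k + l) != 0 by rewrite expf_neq0 ?gt_eqF.
    by move: (t ^+ (k + l)) => q q0; field.
  rewrite -kap6 mulrC; apply: ler_wpM2r; first exact: exprn_ge0.
  have k61 : 6 * kap <= 1 by nra.
  have k60 : 0 <= 6 * kap by lra.
  (* As [6 * kap <= 1] and [0 < m], the power [m] is at most the first power. *)
  by rewrite -(prednK m0) exprS ler_piMr// exprn_ile1.
pose C := [set x | forall i j, 0 <= X x i j <= 1].
have {}PC : P C = 1%E := PC; have {}mC : measurable C := mC.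
exists (C `\` B); split; first exact: measurableD.
  have PD : P (C `\` B) = (1 - P (C `&` B))%E.
    by rewrite -PC; apply: measureD => //;
      exact: le_lt_trans (probability_le1 P mC) (ltry 1).
  have PCB : (P (C `&` B) <= (1 / 2)%:E)%E.
    apply: le_trans PB; apply: le_measure; rewrite ?inE//; first exact: measurableI.
  have fCB : P (C `&` B) \is a fin_num.
    by rewrite fin_num_measure//; exact: measurableI.
  rewrite PD -(fineK fCB) -EFinB lee_fin; move: PCB; rewrite -(fineK fCB) lee_fin.
  lra.
move=> x [Cx Bx]; split=> // b b' b0 bt.
rewrite -(vsubmxK b) in b0 bt *.
have errE : err (row_mx A (X x)) (col_mx (usubmx b) (dsubmx b)) b' =
    `|A *m intmx R (usubmx b) + X x *m intmx R (dsubmx b) + intmx R b'|.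
  by rewrite /err /intmx map_col_mx mul_row_col.
have bi i : `|b i 0|%:~R <= t.
  apply: le_trans bt; rewrite vsubmxK.
  by have := mx_norm_coord (intmx R b) i 0; rewrite mxE intr_norm.
have [b20|b20] := eqVneq (dsubmx b) 0.
  rewrite ge_min; apply/orP; left.
  have b10 : usubmx b != 0 by apply: contra_neq b0 => ->; rewrite b20 col_mx0.
  rewrite errE b20 /intmx map_mx0 mulmx0 addr0; apply: largeA => //.
  apply: mx_norm_le => [|i j]; first exact: ltW.
  by rewrite ord1 !mxE -intr_norm.
rewrite ge_min; apply/orP; right.
pose f : I := [ffun i => inord `|(b i 0 + N%:Z)%R|%N].
have vf : v f = b.
  apply/matrixP => i j; rewrite ord1 mxE ffunE.
  have biN : (`|(b i 0)%R|%N <= N)%N.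
    rewrite -ltnS -(ltr_nat R) -natr1; apply: le_lt_trans tN.
    by rewrite pmulrn abszE.
  by have [lt2N shiftE] := absz_shift biN; rewrite inordK.
have /forallNP/(_ f) := Bx; rewrite /F vf (negbTE b20) => /existsNP[i /forallNP].
move=> /(_ (b' i 0)) /negP; rewrite -leNgt => eb.
rewrite -[kap](divfK (lt0r_neq0 tw0)) -/e mulrC; apply: ler_wpM2l.
  exact: ltW.
rewrite errE; apply: le_trans (mx_norm_coord _ i 0); rewrite mxE.
by apply: le_trans eb _; rewrite [intmx R b' i 0]mxE.
Qed.

(** [L] is the upper limit of events [G j] of probability at least [1 / 2], each good at some
    [t >= j]. In a probability space its measure is at least [1 / 2] too, and a point of [L] lies in
    [G j] for infinitely many [j]. *)
Lemma large_at_limsup (R : realType) (m k l : nat) (A : 'M[R]_(m, k)) (c : R)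
    (w := (k + l)%:R / m%:R : R) :
    (0 < m)%N -> 0 < c -> (forall t0, exists2 t, t0 <= t & large_at A w c t) ->
  exists d (T : measurableType d) (P : probability T R) (X : T -> 'M[R]_(m, l))
    (L : set T),
  [/\ measurable L, (0 < P L)%E,
    forall x, L x -> (forall i j, 0 <= X x i j <= 1) /\
      exists2 c', 0 < c' &
      forall t0, exists2 t, t0 <= t & large_at (row_mx A (X x)) w c' t
  & forall (u : 'M[R]_(m, l)) r, 0 <= r ->
      measurable [set x | forall i j, `|X x i j - u i j| <= r] /\
      (P [set x | forall i j, `|X x i j - u i j| <= r]%R
        <= ((2 * r) ^+ (m * l))%:E)%E].
Proof.
move=> m0 c0 largeA.
have [d [T [P [X [[mC PC] ball slab]]]]] := uniform_matrix R m l.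
pose c' := Num.min c (12 * 3 ^+ (k + l))^-1.
have c'0 : 0 < c' by rewrite lt_min c0 invr_gt0 mulr_gt0// exprn_gt0.
have good (j : nat) : exists G : set T, [/\ measurable G, ((1 / 2)%:E <= P G)%E &
    forall x, G x -> (forall i j, 0 <= X x i j <= 1) /\
    exists2 t, j%:R <= t & large_at (row_mx A (X x)) w c' t].
  (* [j.+1] rather than [j] ensures [1 <= t]. *)
  have [t tj lt] := largeA j.+1%:R.
  have t1 : 1 <= t by apply: le_trans tj; rewrite ler1n.
  have [G [mG PG GP]] := large_at_extension m0 t1 lt mC PC slab.
  exists G; split=> // x Gx; have [Cx lx] := GP x Gx; split=> //.
  by exists t => //; apply: le_trans tj; rewrite ler_nat.
have /choice[G GP] := good.
have mG j : measurable (G j) by case: (GP j).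
have mU i : measurable (\bigcup_(j >= i) G j) by exact: bigcup_measurable.
exists d, T, P, X, (lim_sup_set G); split=> //.
- by apply: bigcapT_measurable.
- apply: (@lt_le_trans _ _ (1 / 2)%:E); first by rewrite lte_fin divr_gt0.
  have cv := lim_sup_set_cvg P G mG (le_lt_trans (probability_le1 P (mU 0%N)) (ltry 1)).
  rewrite -(cvg_lim _ cv)//; apply: lime_ge; first by apply/cvg_ex; eexists; exact: cv.
  apply: nearW => i; have [_ PG _] := GP i; apply: le_trans PG _.
  by apply: le_measure; rewrite ?inE// => x Gx; exists i => /=.
- move=> x Lx; split.
    by have [j _ Gx] := Lx 0%N I; have [_ _ /(_ x Gx)[]] := GP j.
  exists c' => // t0; have [j jt Gx] := Lx (Num.bound `|t0|) I.
  have [_ _ /(_ x Gx)[_ [t tj lt]]] := GP j; exists t => //.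
  apply: le_trans tj; apply: le_trans (ler_norm _) _.
  by apply: le_trans (ltW (archi_boundP _)) _; rewrite ?ler_nat.
Qed.

Lemma small_at_row_mx (R : realType) (m k l : nat) (A : 'M[R]_(m, k))
    (B : 'M[R]_(m, l)) w e t : small_at A w e t -> small_at (row_mx A B) w e t.
Proof.
move=> [b [b' [b0 bt be]]]; exists (col_mx b 0), b'; split.
- by apply: contra_neq b0 => /(congr1 usubmx); rewrite col_mxKu linear0.
- apply: mx_norm_le => [|i j]; first exact: le_trans bt.
  rewrite ord1 !mxE; case: (fintype.split i) => i';
    last by rewrite mxE normr0 (le_trans _ bt).
  by apply: le_trans bt; have := mx_norm_coord (intmx R b) i' 0; rewrite mxE.
- by rewrite /err /intmx map_col_mx mul_row_col map_mx0 mulmx0 addr0.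
Qed.

Lemma full_rank_shift (R : realType) (m n : nat) (a : R) : 0 <= a ->
  exists K : 'M[int]_(m, n), forall A : 'M[R]_(m, n), (forall i j, `|A i j| <= a) ->
    full_rank (A + intmx R K).
Proof.
(* [(m + n) * a] for dominance over the off-diagonal entries, and one more [a] for what [A] may take
   off the diagonal. *)
move=> a0; pose z := Num.bound ((m + n).+1%:R * a).
exists (\matrix_(i, j) if i == j :> nat then z%:Z else 0) => A Aa.
apply: (@dominant_full_rank R m n _ a a0) => i j; rewrite !mxE.
  by move=> /negbTE->; rewrite addr0.
move=> ->; rewrite eqxx -pmulrn.
have : (m + n).+1%:R * a < z%:R by apply: archi_boundP; exact: mulr_ge0.
rewrite -natr1 mulrDl mul1r => za.
rewrite addrC; apply: lt_le_trans (lerB_normD _ _); rewrite ger0_norm//.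
have := Aa i j; lra.
Qed.

(** * Matrices of small positive [Theta], and the theorem *)

Definition singular_level (R : realType) (m n : nat)
    (N1 : 'cV[R]_n -> R) (N2 : 'cV[R]_m -> R) (e : R) : set 'M[R]_(m, n) :=
  [set Omega | [/\ full_rank Omega, (0 < Theta N1 N2 Omega)%E,
    (Theta N1 N2 Omega <= e%:E)%E & (Theta_inf N1 N2 Omega <= 0)%E]].

(** The block is taken at level [e / C1] to absorb the change of norms. Its random completion,
    shifted by one integer matrix that makes all the values considered of full rank, lands in the
    set with positive probability, and the mass distribution principle applies with exponent
    [m * l]. *)
Lemma singular_level_large (R : realType) (m n : nat) (e : R)
    (N1 : 'cV[R]_n -> R) (N2 : 'cV[R]_m -> R) :
    (0 < m)%N -> (0 < n)%N ->
    1 / 2 <= m%:R / n%:R :> R -> m%:R / n%:R <= 2 :> R ->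
    ~ (m = 1%N /\ n = 1%N) -> 0 < e -> is_norm N1 -> is_norm N2 ->
  singular_level N1 N2 e !=set0 /\
  ((m%:R * n%:R - 2 * Num.max m%:R n%:R)%:E <= hausdorff_dim (singular_level N1 N2 e))%E.
Proof.
move=> m0 n0 lo hi mn e0 normN1 normN2.
have [K1 [C1 [K10 C10 psi_le]]] := scaled_psi_le normN1 normN2 n0.
have [K2 [C2 [K20 C20 psi_ge]]] := scaled_psi_ge normN1 normN2 m0 n0.
have [k [l [A [nE dim [[tU U] [c c0 L] Z]]]]] :=
  singular_block_exists m0 n0 lo hi mn (divr_gt0 e0 C10).
subst n.
have [d [T [P [X [G [mG PG GP ballX]]]]]] := large_at_limsup m0 c0 L.
have [K KP] := @full_rank_shift R m (k + l) (`|A| + 1) (addr_ge0 (normr_ge0 _) ler01).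
pose F x := row_mx A (X x) + intmx R K.
have EF x : G x -> singular_level N1 N2 e (F x).
  move=> Gx; have [X01 [c' c'0 Lx]] := GP x Gx.
  have spE := scaled_psi_shift N1 N2 K (row_mx A (X x)).
  have sU t e' : small_at A ((k + l)%:R / m%:R) e' t ->
      (scaled_psi N1 N2 (F x) (K1 * t) <= (C1 * e')%:E)%E.
    by rewrite spE => /(small_at_row_mx (X x))/psi_le.
  split.
  - apply: KP => i j; rewrite mxE; case: fintype.split => j'.
      by apply: le_trans (mx_norm_coord _ _ _) _; rewrite lerDl.
    have /andP[x0 x1] := X01 i j'; rewrite ger0_norm//; apply: le_trans x1 _.
    by rewrite lerDr.
  - apply: (@lt_le_trans _ _ (C2 * c')%:E); first by rewrite lte_fin mulr_gt0.
    apply: Theta_ge => t0.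
    (* This threshold makes [t] positive and [K2 * t] larger than [t0] at once. *)
    have [t tt0 Lt] := Lx (Num.max 0 (t0 / K2) + 1).
    have t_gt0 : 0 < t by apply: lt_le_trans tt0; rewrite ltr_pwDr// le_max lexx.
    exists (K2 * t); last by rewrite spE; exact: psi_ge.
    rewrite mulrC -ltr_pdivrMr//; apply: lt_le_trans tt0.
    by apply: (@le_lt_trans _ _ (Num.max 0 (t0 / K2)));
      rewrite ?le_max ?lexx ?orbT// ltrDl.
  - apply: (@Theta_le _ _ _ _ _ _ (K1 * tU)) => t tUt.
    have -> : t = K1 * (t / K1) by rewrite mulrC divfK// gt_eqF.
    rewrite -[e](divfK (lt0r_neq0 C10)) [_ * C1]mulrC; apply/sU/U.
    by rewrite ler_pdivlMr// mulrC.
  - apply: Theta_inf_le0 => h t0 h0.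
    have [t tt0 zt] := Z (h / C1) (t0 / K1 + 1) (divr_gt0 h0 C10).
    exists (K1 * t).
      rewrite mulrC -ltr_pdivrMr//; apply: lt_le_trans tt0; by rewrite ltrDl.
    by have := sU _ _ zt; rewrite [C1 * _]mulrC divfK// gt_eqF.
split.
  have : G !=set0 by apply/set0P/eqP => G0; move: PG; rewrite G0 measure0 ltxx.
  by move=> [x /EF]; exists (F x).
apply: (@le_trans _ _ ((m * l)%:R : R)%:E); first by rewrite lee_fin.
apply: (@mass_distribution R _ d T P F G _ (2 ^+ (m * l))) => // u r r0.
(* Closeness of [F x] to [u] is read off on the random columns: these are close to the last [l]
   columns of [u] with the integer shift taken back. *)
have [mM PM] := ballX (\matrix_(i, j) (u i (rshift k j) - (K i (rshift k j))%:~R)) r r0.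
eexists; split; [exact: mM| |by rewrite -exprMn; exact: PM].
move=> x xu i j; apply: le_trans xu.
apply: le_trans (mx_norm_coord _ i (rshift k j)).
by rewrite -(row_mxEr A (X x)) !mxE opprB addrA addrAC.
Qed.

(** A finite set deprived of [p] is closed, so its complement is a neighbourhood of [p] that meets
    [E] at most in [p]. *)
Lemma limit_point_infinite (T : topologicalType) (E : set T) (p : T) :
  hausdorff_space T -> limit_point E p -> infinite_set E.
Proof.
move=> hT Ep finE.
have cl : closed (E `\ p).
  apply: accessible_finite_set_closed.1; first exact: hausdorff_accessible.
  exact: finite_setD.
have : nbhs p (~` (E `\ p)).
  by apply: open_nbhs_nbhs; split; [exact: closed_openC|move=> [_]; exact].
by move=> /Ep[y [/eqP yp Ey]]; apply.
Qed.

Lemma max_norm_is_norm (R : realType) k : is_norm (@max_norm R k).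
Proof.
split=> [x y|a x|x]; rewrite /max_norm; [exact: ler_normD|exact: normrZ|].
exact: normr0_eq0.
Qed.

Theorem theorem3p5 (R : realType) (m n : nat)
  (m_gt0 : (0 < m)%N) (n_gt0 : (0 < n)%N)
  (mn_ratio : 1 / 2 <= m%:R / n%:R :> R /\ m%:R / n%:R <= 2 :> R)
  (mn_not11 : [set m; n] <> [set 1%N; 1%N])
  (mn_not23 : [set m; n] <> [set 2%N; 3%N]) :
  let d : \bar R := ((m%:R * n%:R - 2 * Num.max m%:R n%:R) : R)%:E in
  let FSmax : set 'M[R]_(m, n) := FS (@max_norm R n) (@max_norm R m) in
  [/\ FSmax !=set0 /\ (d <= hausdorff_dim FSmax)%E,
      FSmax `&` @full_rank R m n !=set0 /\
        (d <= hausdorff_dim (FSmax `&` @full_rank R m n))%E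
    & m <> n ->
      forall (N1 : 'cV[R]_n -> R) (N2 : 'cV[R]_m -> R),
        is_norm N1 -> is_norm N2 ->
        [/\ FS N1 N2 !=set0,
            (d <= hausdorff_dim (FS N1 N2))%E,
            limit_point (dirichlet_spectrum N1 N2) 0%E
          & ~ finite_set (dirichlet_spectrum N1 N2)]].
Proof.
move=> d FSmax; have [lo hi] := mn_ratio.
have mn : ~ (m = 1%N /\ n = 1%N) by move=> [m1 n1]; apply: mn_not11; rewrite m1 n1.
have level N1 N2 e := @singular_level_large R m n e N1 N2 m_gt0 n_gt0 lo hi mn.
have subFS N1 N2 : is_norm N1 -> is_norm N2 -> exists2 e, 0 < e &
    singular_level N1 N2 e `<=` FS N1 N2 `&` @full_rank R m n.
  move=> normN1 normN2.
  (* One matrix of level 1 bounds Dirichlet's constant below by [th > 0]; the level [th / 2] is then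
     strictly below that constant. *)
  have [[Om [_ Om0 Om1 _]] _] := level N1 N2 1 ltr01 normN1 normN2.
  pose th := fine (Theta N1 N2 Om).
  have thE : Theta N1 N2 Om = th%:E.
    by rewrite fineK// ge0_fin_numE ?ltW//; apply: le_lt_trans Om1 (ltry _).
  have th0 : 0 < th by rewrite -lte_fin -thE.
  exists (th / 2) => [|A [fA A0 Ae Ai]]; first by rewrite divr_gt0.
  split=> //; split.
    apply: (@lt_le_trans _ _ th%:E).
      by apply: le_lt_trans Ae _; rewrite lte_fin; lra.
    by rewrite -thE; apply: ereal_sup_ubound; exists Om.
  move=> [A1|A1]; first by move: Ai; rewrite leNgt => /negP; apply; exact: A1.
  have A2 : Theta N1 N2 A = 0%E := A1; by move: A0; rewrite A2 ltxx.
have large N1 N2 : is_norm N1 -> is_norm N2 ->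
    FS N1 N2 `&` @full_rank R m n !=set0 /\
    (d <= hausdorff_dim (FS N1 N2 `&` @full_rank R m n))%E.
  move=> normN1 normN2; have [e e0 eFS] := subFS N1 N2 normN1 normN2.
  have [[A Ae] dimA] := level N1 N2 e e0 normN1 normN2; split.
    by exists A; exact: eFS.
  exact: le_trans dimA (hausdorff_dim_mono eFS).
have largeFS (N1 : 'cV[R]_n -> R) (N2 : 'cV[R]_m -> R) : is_norm N1 -> is_norm N2 ->
    FS N1 N2 !=set0 /\ (d <= hausdorff_dim (FS N1 N2))%E.
  move=> normN1 normN2; have [[A [FA _]] dimA] := large N1 N2 normN1 normN2.
  split; first by exists A.
  by apply: le_trans dimA _; apply: hausdorff_dim_mono; exact: subIsetl.
split; [exact: largeFS (max_norm_is_norm _ _) (max_norm_is_norm _ _)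
       |exact: large (max_norm_is_norm _ _) (max_norm_is_norm _ _)|].
move=> _ N1 N2 normN1 normN2; have [FS0 dimFS] := largeFS N1 N2 normN1 normN2.
have lim0 : limit_point (dirichlet_spectrum N1 N2) 0%E.
  (* At a finite point the neighbourhoods in the extended reals come from the real line; the level
     [r / 2] then gives a nonzero element of the spectrum within [r] of 0. *)
  move=> U U0; have : nbhs (0 : R) (fun y => U y%:E) := U0.
  move=> /nbhs_ballP[r /= r0 rU].
  have [[A [_ A0 Ae _]] _] := level N1 N2 (r / 2) (divr_gt0 r0 (ltr0n R 2)) normN1 normN2.
  have AE : Theta N1 N2 A = (fine (Theta N1 N2 A))%:E.
    by rewrite fineK// ge0_fin_numE ?ltW//; apply: le_lt_trans Ae (ltry _).
  exists (Theta N1 N2 A); split; [by rewrite gt_eqF|by exists A|].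
  rewrite AE; apply: rU; rewrite /ball /= sub0r normrN ger0_norm; last first.
    by rewrite fine_ge0// ltW.
  by rewrite -lte_fin -AE; apply: le_lt_trans Ae _; rewrite lte_fin; lra.
split=> //; exact: limit_point_infinite (@ereal_hausdorff R) lim0.
Qed.
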